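(* Let $\mathcal{F}$ be a finite family of graphs with $\min_{F\in\mathcal{F}}\chi(F)=r+1\geq 3$. For every $\theta>0$ there exists $n_0$ such that if $n\geq n_0$ and $G\in \mathrm{SPEX}(n,\mathcal{F})$, then $G$ is connected and its minimum degree satisfies $\delta(G)>\left(\frac{r-1}{r}-\theta\right)n$.
   Context: All graphs are finite, undirected, simple. $\chi(F)$ is the chromatic number. The spectral radius $\rho(G)$ is the largest eigenvalue of the adjacency matrix of $G$. A graph is $\mathcal{F}$-free if it contains no $F\in\mathcal{F}$ as a (not necessarily induced) subgraph. $\mathrm{SPEX}(n,\mathcal{F})$ is the set of $\mathcal{F}$-free graphs of order $n$ having the maximum spectral radius among all $\mathcal{F}$-free graphs of order $n$. *)

(* Defs.v *)
From mathcomp Require Import all_boot all_order all_algebra.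
From mathcomp Require Import boolp classical_sets reals.
From mathcomp Require polyrcf complex.

Set Implicit Arguments.
Unset Strict Implicit.
Unset Printing Implicit Defensive.

Import Order.TTheory GRing.Theory Num.Theory.

Local Open Scope ring_scope.

Record sgraph := SGraph {
  vertex :> finType;
  adj : rel vertex;
  adj_sym : symmetric adj;
  adj_irr : irreflexive adj
}.

Definition colorable (G : sgraph) (k : nat) : bool :=
  [exists f : {ffun G -> 'I_k},
    [forall x : G, forall y : G, adj x y ==> (f x != f y)]].

Lemma colorable_ex (G : sgraph) : exists k, colorable G k.
Proof.
exists #|G|; apply/existsP; exists [ffun x => enum_rank x].
apply/'forall_forallP => x y; apply/implyP => xy; rewrite !ffunE.
by apply: contraTneq xy => /enum_rank_inj ->; rewrite adj_irr.
Qed.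

Definition chromatic_number (G : sgraph) : nat := ex_minn (colorable_ex G).

(* Not necessarily induced subgraphs. *)
Definition contains (G F : sgraph) : Prop :=
  exists f : F -> G, injective f /\ forall x y : F, adj x y -> adj (f x) (f y).

Definition family_free (I : finType) (F : I -> sgraph) (G : sgraph) : Prop :=
  forall i : I, ~ contains G (F i).

Definition family_min_chromatic (I : finType) (F : I -> sgraph) (k : nat) :
    Prop :=
  (exists i : I, chromatic_number (F i) = k) /\
  (forall i : I, (k <= chromatic_number (F i))%N).

Definition connected_graph (G : sgraph) : Prop :=
  forall x y : G, connect (@adj G) x y.

Definition degree (G : sgraph) (x : G) : nat := #|[set y : G | adj x y]|.

(* Every degree is below #|G|, so the default value #|G| is never the minimum
   unless G has no vertex. *)
Definition min_degree (G : sgraph) : nat :=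
  \big[minn/#|G|]_(x : G) degree x.

Definition adjmx (R : realType) (G : sgraph) : 'M[R]_#|G| :=
  \matrix_(i, j) (adj (enum_val i) (enum_val j))%:R.

(* The supremum is a maximum as soon as G has a vertex, see
   spectral_radiusP. *)
Definition spectral_radius (R : realType) (G : sgraph) : R :=
  sup [set a : R | eigenvalue (adjmx R G) a]%classic.

Definition SPEX (R : realType) (n : nat) (I : finType) (F : I -> sgraph)
    (G : sgraph) : Prop :=
  [/\ #|G| = n, family_free F G &
      forall H : sgraph, #|H| = n -> family_free F H ->
        spectral_radius R H <= spectral_radius R G].

Section SpectralRadiusMax.
Import polyrcf complex.

Lemma sym_eigenvalue_ex (R : rcfType) (n : nat) (A : 'M[R]_n) :
  (0 < n)%N -> A^T = A -> exists a, eigenvalue A a.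
Proof.
move=> n_gt0 symA; pose AC := map_mx (real_complex R) A.
have /closed_rootP[[a b]] : size (char_poly AC) != 1%N
  by rewrite size_char_poly eqSS -lt0n.
rewrite -eigenvalue_root_char.
case/eigenvalueP=> v vA v_neq0.
pose x := map_mx (@complex.Re R) v; pose y := map_mx (@complex.Im R) v.
have ReS m (f : 'I_m -> R[i]%C) :
    complex.Re (\sum_i f i) = \sum_i complex.Re (f i).
  by apply: (big_morph (@complex.Re R)) => [[? ?] [? ?]|].
have ImS m (f : 'I_m -> R[i]%C) :
    complex.Im (\sum_i f i) = \sum_i complex.Im (f i).
  by apply: (big_morph (@complex.Im R)) => [[? ?] [? ?]|].
have xA : x *m A = a *: x - b *: y.
  apply/rowP=> j; move/rowP/(_ j): vA => /(congr1 (@complex.Re R)).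
  rewrite !mxE ReS; case: (v 0 j) (erefl (v 0 j)) => r s Ev /= <-.
  by apply: eq_bigr => i _; rewrite !mxE; case: (v 0 i) => ? ? /=;
     rewrite mulr0 subr0.
have yA : y *m A = b *: x + a *: y.
  apply/rowP=> j; move/rowP/(_ j): vA => /(congr1 (@complex.Im R)).
  rewrite !mxE ImS; case: (v 0 j) (erefl (v 0 j)) => r s Ev /=.
  rewrite [RHS]addrC => <-.
  by apply: eq_bigr => i _; rewrite !mxE; case: (v 0 i) => ? ? /=;
     rewrite mulr0 add0r.
have dot_sym (u w : 'rV[R]_n) : u *m w^T = w *m u^T.
  by apply/matrixP=> i j; rewrite !ord1 !mxE; apply: eq_bigr => k _;
     rewrite !mxE mulrC.
have dot_ge0 (u : 'rV[R]_n) : 0 <= (u *m u^T) 0 0.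
  by rewrite mxE sumr_ge0 // => k _; rewrite !mxE -expr2 sqr_ge0.
have dot_eq0 (u : 'rV[R]_n) : (u *m u^T) 0 0 = 0 -> u = 0.
  move=> /eqP; rewrite mxE psumr_eq0; last first.
    by move=> k _; rewrite !mxE -expr2 sqr_ge0.
  move/allP=> u0; apply/rowP=> k; rewrite mxE.
  by have := u0 k (mem_index_enum _); rewrite !mxE mulf_eq0 orbb => /eqP.
have : x *m A *m y^T = y *m A *m x^T.
  by rewrite -[RHS]mulmxA -{2}symA -trmx_mul dot_sym.
rewrite xA yA mulmxBl mulmxDl -!scalemxAl (dot_sym y x) [RHS]addrC.
move/addrI/matrixP/(_ 0 0); rewrite !mxE.
move=> Hb.
have {}Hb : b * ((x *m x^T) 0 0 + (y *m y^T) 0 0) = 0.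
  by rewrite !mxE mulrDr -Hb addNr.
have b0 : b = 0.
  apply: contraNeq v_neq0 => b_neq0; move/eqP: Hb.
  rewrite mulf_eq0 (negPf b_neq0) /= paddr_eq0 //.
  case/andP=> /eqP/dot_eq0/rowP x0 /eqP/dot_eq0/rowP y0; apply/eqP/rowP=> j.
  move: (x0 j) (y0 j); rewrite !mxE.
  by case: (v 0 j) => ? ? /= -> ->.
exists a; apply/eigenvalueP; have [x0|x_neq0] := eqVneq x 0; last first.
  by exists x; rewrite // xA b0 scale0r subr0.
exists y; first by rewrite yA b0 scale0r add0r.
apply: contraNneq v_neq0 => y0; apply/eqP/rowP=> j.
move: x0 y0 => /rowP/(_ j) x0 /rowP/(_ j) y0; move: x0 y0; rewrite !mxE.
by case: (v 0 j) => ? ? /= -> ->.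
Qed.

Lemma spectral_radiusP (R : realType) (G : sgraph) : (0 < #|G|)%N ->
  eigenvalue (adjmx R G) (spectral_radius R G) /\
  (forall a, eigenvalue (adjmx R G) a -> a <= spectral_radius R G).
Proof.
move=> G_gt0; set A := adjmx R G.
have symA : A^T = A by apply/matrixP=> i j; rewrite !mxE adj_sym.
have [a0 Aa0] := sym_eigenvalue_ex G_gt0 symA.
have pA_neq0 : char_poly A != 0 by rewrite monic_neq0 ?char_poly_monic.
pose s := rootsR (char_poly A).
have sE a : (a \in s) = eigenvalue A a.
  by rewrite -(roots_on_rootsR pA_neq0 a) eigenvalue_root_char in_itv.
pose m := \big[Num.max/a0]_(a <- s) a.
have Am : eigenvalue A m.
  rewrite /m big_seq; elim/big_ind: _ => // [a b ? ?|a]; last by rewrite sE.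
  by case: leP.
have m_ub a : eigenvalue A a -> a <= m by rewrite -sE => ?; exact: le_bigmax_seq.
suff -> : spectral_radius R G = m by [].
apply/le_anti/andP; split; first by apply: ge_sup; [exists m | move=> a /m_ub].
by apply: ub_le_sup => //; exists m => a /m_ub.
Qed.

End SpectralRadiusMax.

(* Main.v *)
(** Let [x] be a nonnegative vector with [rho x <= A x], normalised to have mean
    [1]. Replacing the neighbourhood of a vertex [u] by the common neighbourhood
    of a set [T] of more than [|F_i| + 1] vertices creates no copy of [F_i],
    since [u] can be traded for an unused vertex of [T]; maximality of [rho]
    then gives [sum_(w in CN(T)) x w <= sum_(w in N(u)) x w]. It remains to see
    that [x] is close to [1] in mean square and that some [T] has about
    [(1 - 1/r) n] common neighbours.

    A weighted Erdos-Stone theorem applied to [x / n] gives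
    [rho |x|^2 <= (1 - 1/r + o(1)) n^2], while the Turan graph gives
    [rho >= (1 - 1/r) n - 1]; hence [|x|^2 <= (1 + o(1)) n] and [x] is nearly
    constant. Almost all vertices therefore have degree about [(1 - 1/r) n], so
    they span a complete [r]-partite graph with large parts of size [M]. As all
    but boundedly many vertices miss most of one of the parts, degree counting
    shows that, for some part, all but about [n / r] vertices are joined to
    almost all of it; a few well-chosen vertices of that part form [T]. *)
Require Import Defs.
From mathcomp Require Import all_boot all_order all_algebra.
From mathcomp Require Import boolp classical_sets reals.
From mathcomp Require complex.
From mathcomp Require Import ring lra.
Set Implicit Arguments.
Unset Strict Implicit.
Unset Printing Implicit Defensive.
Import Order.TTheory GRing.Theory Num.Theory.
Local Open Scope ring_scope.

(** * Rayleigh quotients and the spectral radius *)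

Section Rayleigh.
Import complex.
Local Open Scope sesquilinear_scope.

(** Over [R[i]] the matrix is Hermitian, so it is unitarily diagonalisable with real diagonal [d].
    In the coordinates [z] the quadratic form is the sum of [d 0 j] times the squared modulus of
    [z 0 j]. *)
Lemma sym_rayleigh (R : rcfType) (n : nat) (A : 'M[R]_n) (m : R) :
  A^T = A -> (forall a, eigenvalue A a -> a <= m) ->
  forall y : 'rV[R]_n, (y *m A *m y^T) 0 0 <= m * (y *m y^T) 0 0.
Proof.
move=> symA Am y.
pose toC := real_complex R; pose AC := map_mx toC A; pose yC := map_mx toC y.
have realM p q (B : 'M[R]_(p, q)) : map_mx toC B \is a mxOver Num.real.
  by apply/mxOverP=> i j; rewrite mxE; apply/complex_realP; exists (B i j).
have hermA : AC \is hermsymmx.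
  apply: realsym_hermsym; last exact: realM.
  by apply/is_hermitianmxP; rewrite expr0 scale1r map_mx_id // /AC map_trmx symA.
have /orthomx_spectralP := hermitian_normalmx hermA.
have := hermitian_spectral_diag_real hermA.
have := spectral_unitarymx AC.
move: (spectralmx AC) (spectral_diag AC) => P d unitP real_d AE.
have Pu := unitarymx_unit unitP.
(* Row [j] of [P] is an eigenvector of [AC] for [d 0 j]. This entry is real, so it is already an
   eigenvalue of [A] over [R]. *)
have d_le j : d 0 j <= toC m.
  have dj_real : d 0 j \is Num.real by move/mxOverP: real_d; exact.
  have djE : d 0 j = toC (Re (d 0 j)) by rewrite /toC /= RRe_real.
  rewrite djE lecR; apply: Am.
  have <- : eigenvalue AC (d 0 j) = eigenvalue A (Re (d 0 j)).
    by rewrite [in LHS]djE (eigenvalue_map (real_complex R)).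
  apply/eigenvalueP; exists (row j P); last first.
    apply: contraTneq Pu => Pj0; rewrite -row_free_unit negb_row_free.
    by apply/existsP; exists j; rewrite Pj0 sub0mx.
  by rewrite AE !mulmxA -!row_mul mulmxV // mul1mx row_mul row_diag_mx
             -scalemxAl -rowE.
pose z := yC *m P^t*.
have zz : (yC *m yC^t*) = z *m z^t*.
  rewrite /z trmx_mul map_mxM trmxCK mulmxA -(mulmxA yC) -invmx_unitary //.
  by rewrite mulVmx // mulmx1.
have yCt : yC^t* = map_mx toC y^T.
  by rewrite /yC map_trmx realmxC ?realM.
have zAz : yC *m AC *m yC^t* = z *m diag_mx d *m z^t*.
  by rewrite /z trmx_mul map_mxM trmxCK AE invmx_unitary // !mulmxA.
suff : toC ((y *m A *m y^T) 0 0) <= toC m * toC ((y *m y^T) 0 0).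
  by rewrite /toC -(rmorphM (real_complex R)) lecR.
have -> : toC ((y *m A *m y^T) 0 0) = (z *m diag_mx d *m z^t*) 0 0.
  by rewrite -zAz yCt -!(map_mxM (real_complex R)) [RHS]mxE.
have -> : toC ((y *m y^T) 0 0) = (z *m z^t*) 0 0.
  by rewrite -zz yCt -!(map_mxM (real_complex R)) [RHS]mxE.
move: (z) => {zz zAz}w; rewrite !mxE mulr_sumr; apply: ler_sum => j _.
rewrite mul_mx_diag !mxE mulrAC mulrC; apply: ler_wpM2r; last exact: d_le.
exact: mul_conjC_ge0.
Qed.
End Rayleigh.

Section Spectral.
Context {R : realType} (G : sgraph).
Local Notation rho := (spectral_radius R G).

Lemma sum_ord_vertex (f : G -> R) : \sum_(i < #|G|) f (enum_val i) = \sum_v f v.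
Proof. by rewrite -(big_enum_val f). Qed.

Lemma mul_adjmxE (x : G -> R) j :
  ((\row_i x (enum_val i)) *m adjmx R G) 0 j = \sum_(w | adj (enum_val j) w) x w.
Proof.
rewrite mxE [RHS]big_mkcond /= -sum_ord_vertex; apply: eq_bigr => i _.
by rewrite !mxE adj_sym; case: adj; rewrite ?mulr1 ?mulr0.
Qed.

Lemma spectral_rayleigh (x : G -> R) : (0 < #|G|)%N ->
  \sum_v x v * (\sum_(w | adj v w) x w) <= rho * \sum_v x v ^+ 2.
Proof.
move=> G_gt0; have [_ rho_max] := spectral_radiusP R G_gt0.
have symA : (adjmx R G)^T = adjmx R G.
  by apply/matrixP=> i j; rewrite !mxE adj_sym.
have := sym_rayleigh symA rho_max (\row_i x (enum_val i)).
rewrite [X in X <= _]mxE [X in _ * X]mxE -!sum_ord_vertex.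
under eq_bigr => i _ do rewrite mul_adjmxE !mxE mulrC.
by under [X in _ * X]eq_bigr => i _ do rewrite !mxE -expr2.
Qed.

(** Take absolute values in an eigenvector for [rho], then rescale. The triangle inequality turns
    the eigenvalue equation into the stated inequality, which stands in for a Perron vector. *)
Lemma spectral_subeigenvector : (0 < #|G|)%N ->
  exists x : G -> R, [/\ forall v, 0 <= x v, \sum_v x v = #|G|%:R &
    forall v, rho * x v <= \sum_(w | adj v w) x w].
Proof.
move=> G_gt0; have [/eigenvalueP[y yA y_neq0] _] := spectral_radiusP R G_gt0.
pose z (v : G) := `|y 0 (enum_rank v)|.
have z_ge0 v : 0 <= z v by exact: normr_ge0.
have z_sub v : rho * z v <= \sum_(w | adj v w) z w.
  have /rowP/(_ (enum_rank v)) := yA.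
  have {1}-> : y = \row_i y 0 (enum_rank (enum_val i)).
    by apply/rowP=> i; rewrite mxE enum_valK.
  rewrite (mul_adjmxE (fun v => y 0 (enum_rank v))) enum_rankK mxE => yE.
  apply: le_trans (ler_norm_sum _ _ _); rewrite yE normrM.
  by apply: ler_wpM2r => //; exact: ler_norm.
have s_gt0 : 0 < \sum_v z v.
  rewrite lt_def sumr_ge0 // andbT psumr_eq0 //.
  apply: contraNN y_neq0 => /allP z0; apply/eqP/rowP=> i.
  have := z0 (enum_val i) (mem_index_enum _).
  by rewrite /z enum_valK normr_eq0 mxE => /eqP.
exists (fun v => #|G|%:R / (\sum_v z v) * z v); split=> [v||v].
- by rewrite mulr_ge0 // divr_ge0 // ltW.
- by rewrite -mulr_sumr mulfVK ?gt_eqF.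
- rewrite -mulr_sumr mulrCA; apply: ler_wpM2l => //.
  by rewrite divr_ge0 // ltW.
Qed.
End Spectral.

(** * A weighted Erdos-Stone theorem *)

Section Weighted.
Context {R : realType} {G : sgraph}.
Implicit Types p : G -> R.

Definition mass p := \sum_v p v.
Definition link p (v : G) : G -> R := fun w => p w * (adj v w)%:R.
(** The weighted number of ordered adjacent pairs; [wedges p / mass p ^+ 2] is the edge density.
    Likewise [cliques k] weighs ordered [k]-cliques, peeling off one vertex at a time. *)
Definition wedges p := \sum_v p v * mass (link p v).

Fixpoint cliques k p :=
  if k is k'.+1 then \sum_v p v * cliques k' (link p v) else 1.

Lemma link_ge0 p v : (forall w, 0 <= p w) -> forall w, 0 <= link p v w.
Proof. by move=> p_ge0 w; rewrite mulr_ge0. Qed.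

Lemma mass_ge0 p : (forall w, 0 <= p w) -> 0 <= mass p.
Proof. by move=> p_ge0; apply: sumr_ge0. Qed.

Lemma mass_link_le p v : (forall w, 0 <= p w) -> mass (link p v) <= mass p.
Proof.
by move=> p_ge0; apply: ler_sum => w _; rewrite ler_piMr // lern1 leq_b1.
Qed.

Lemma cliques_ge0 k p : (forall w, 0 <= p w) -> 0 <= cliques k p.
Proof.
elim: k p => //= k IH p p_ge0; apply: sumr_ge0 => v _.
by rewrite mulr_ge0 // IH //; exact: link_ge0.
Qed.

Lemma wedges_ge0 p : (forall w, 0 <= p w) -> 0 <= wedges p.
Proof.
move=> p_ge0; apply: sumr_ge0 => v _; rewrite mulr_ge0 // mass_ge0 //.
exact: link_ge0.
Qed.

Lemma wedges_le p : (forall w, 0 <= p w) -> wedges p <= mass p ^+ 2.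
Proof.
move=> p_ge0; rewrite expr2 {1}/mass mulr_suml; apply: ler_sum => v _.
by rewrite ler_wpM2l // mass_link_le.
Qed.

(* Goodman's bound: two neighbourhoods inside a set of mass [m] meet in mass at
   least [d_v + d_w - m]. *)
Lemma wedges_link_ge p : (forall w, 0 <= p w) ->
  0 <= \sum_v p v * (wedges (link p v) - 2 * mass (link p v) ^+ 2
                     + mass p * mass (link p v)).
Proof.
move=> p_ge0; set m := mass p; pose d v := mass (link p v).
have codeg v w : d v + d w - m <= mass (link (link p v) w).
  rewrite /d /m /mass -big_split -sumrB; apply: ler_sum => u _ /=.
  rewrite /link; have := p_ge0 u.
  by case: (adj v u); case: (adj w u) => /=; rewrite ?(mulr1, mulr0) => ?; lra.
have wedges_ge v : d v ^+ 2 + \sum_w link p v w * d w - m * d v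
    <= wedges (link p v).
  have -> : d v ^+ 2 + \sum_w link p v w * d w - m * d v =
      \sum_w link p v w * (d v + d w - m).
    under [RHS]eq_bigr => w _ do rewrite mulrBr mulrDr.
    by rewrite sumrB big_split /= -!mulr_suml -/(mass (link p v)) -/(d v); ring.
  by apply: ler_sum => w _; rewrite ler_wpM2l //; exact: link_ge0.
(* Double counting over adjacent pairs: [w] occurs with weight [p w * d w] once for each neighbour
   [v]. *)
have swap : \sum_v p v * (\sum_w link p v w * d w) = \sum_v p v * d v ^+ 2.
  under eq_bigr do rewrite mulr_sumr.
  rewrite exchange_big /=; apply: eq_bigr => w _.
  transitivity (p w * d w * mass (link p w)); last by rewrite -/(d w); ring.
  rewrite /mass mulr_sumr; apply: eq_bigr => v _.
  by rewrite /link adj_sym; ring.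
have zero : \sum_v p v * (d v ^+ 2 + \sum_w link p v w * d w - m * d v
    - 2 * d v ^+ 2 + m * d v) = 0.
  rewrite -[RHS](subrr (\sum_v p v * d v ^+ 2)) -{1}swap -sumrB.
  by apply: eq_bigr => v _; ring.
rewrite -[leLHS]zero; apply: ler_sum => v _; rewrite ler_wpM2l // -/(d v).
by have := wedges_ge v; lra.
Qed.

(** Cauchy-Schwarz, obtained from the nonnegativity of the weighted variance of
    [v |-> mass (link p v)]. *)
Lemma wedges_sqr_le p : (forall w, 0 <= p w) -> 0 < mass p ->
  wedges p ^+ 2 <= mass p * \sum_v p v * mass (link p v) ^+ 2.
Proof.
move=> p_ge0; set m := mass p => m_gt0; set e := wedges p.
pose d v := mass (link p v); rewrite -[leRHS]/(m * \sum_v p v * d v ^+ 2).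
have Sd : \sum_v p v * d v = e by [].
have Sp : \sum_v p v = m by [].
move: m e d m_gt0 Sd Sp => m e d m_gt0 Sd Sp.
have : 0 <= \sum_v p v * (m * d v - e) ^+ 2.
  by apply: sumr_ge0 => v _; rewrite mulr_ge0 // sqr_ge0.
have -> : \sum_v p v * (m * d v - e) ^+ 2 =
    m * (m * (\sum_v p v * d v ^+ 2) - e ^+ 2).
  transitivity (m ^+ 2 * (\sum_v p v * d v ^+ 2)
      - 2 * m * e * (\sum_v p v * d v) + e ^+ 2 * (\sum_v p v)).
    rewrite !mulr_sumr -sumrB -big_split /=.
    by apply: eq_bigr => v _; ring.
  by rewrite Sd Sp; ring.
by rewrite pmulr_rge0 // subr_ge0.
Qed.

(* By Goodman's bound and convexity, the vertices whose link has density at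
   least [1 - a + eps] carry a fixed proportion of [sum_v p v * d v ^+ 2]. *)
Lemma supersaturation_step k p (a eps c : R) : (forall w, 0 <= p w) ->
  0 < mass p -> 0 < a -> a <= 1 -> 0 < eps -> 0 <= c ->
  (forall q : G -> R, (forall w, 0 <= q w) ->
    (1 - a + eps) * mass q ^+ 2 <= wedges q ->
    c * mass q ^+ k.+2 <= cliques k.+2 q) ->
  (1 - (1 + a^-1)^-1 + eps) * mass p ^+ 2 <= wedges p ->
  c * (a * eps ^+ 2 / 2) ^+ k * (a * eps ^+ 2 / 2) * mass p ^+ k.+3
    <= cliques k.+3 p.
Proof.
move=> p_ge0 m_gt0 a_gt0 a_le1 eps_gt0 c_ge0 IH ep.
set m := mass p; set e := wedges p; pose d v := mass (link p v).
pose eta := a * eps ^+ 2 / 2; rewrite -/eta.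
have link0 v w : 0 <= link p v w by exact: link_ge0.
have d_ge0 v : 0 <= d v by exact: mass_ge0.
have d_le v : d v <= m by exact: mass_link_le.
have e_le : e <= m ^+ 2 by exact: wedges_le.
set D := 1 - (1 + a^-1)^-1 + eps in ep.
have D_le1 : D <= 1.
  by rewrite -(ler_pM2r (exprn_gt0 2 m_gt0)) mul1r; exact: le_trans e_le.
(* Here [D = (1 + a)^-1 + eps], and [(1 + a)^-1] is exactly the density at which
   [(1 + a) * e - m ^+ 2] becomes nonnegative; the surplus [eps] leaves a gain of [a * eps]. *)
have aD : 1 + a * eps <= (1 + a - eps) * D.
  have -> : (1 + a - eps) * D = 1 + eps * (1 + a) - eps * D.
    by rewrite /D; field; rewrite !gt_eqF // addr_gt0.
  have : eps * D <= eps by rewrite ler_piMr // ltW.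
  lra.
have D_ge : eps <= D.
  by rewrite /D lerDr subr_ge0 invf_le1 ?addr_gt0 ?invr_gt0 // lerDl invr_ge0 ltW.
have eps_le1 : eps <= 1 by exact: le_trans D_le1.
have eta_gt0 : 0 < eta by rewrite !mulr_gt0 ?exprn_gt0 ?invr_gt0.
have eta_le1 : eta <= 1.
  rewrite /eta ler_pdivrMr // mul1r (le_trans _ (ler1n _ 2)) //.
  by rewrite mulr_ile1 ?exprn_ile1 // ltW // exprn_gt0.
pose good v := (1 - a + eps) * d v ^+ 2 <= wedges (link p v).
pose S := \sum_v p v * d v ^+ 2.
have S_ge : e ^+ 2 <= m * S by exact: wedges_sqr_le.
(* In Goodman's sum, bound [wedges (link p v)] by [d v ^+ 2] at good vertices and by
   [(1 - a + eps) * d v ^+ 2] at the others. Then [S >= e ^+ 2 / m] and [e >= D * m ^+ 2] give the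
   bound. *)
have good_sum : 2 * eta * m ^+ 3 <= \sum_(v | good v) p v * d v ^+ 2.
  set g := \sum_(v | _) _.
  have gS : 0 <= g - (1 + a - eps) * S + m * e.
    apply: le_trans (wedges_link_ge p_ge0) _.
    have -> : m * e = \sum_v p v * (m * d v).
      by rewrite mulr_sumr; apply: eq_bigr => v _; rewrite mulrCA.
    rewrite /g [X in X - _]big_mkcond mulr_sumr -sumrB -big_split /=.
    apply: ler_sum => v _; rewrite -/m -/(d v).
    case: ifP => [_|/negbT].
      have := wedges_le (link0 v); rewrite -/(d v) => /(ler_wpM2l (p_ge0 v)).
      have : 0 <= p v * d v ^+ 2 by rewrite mulr_ge0 // exprn_ge0.
      nra.
    rewrite -ltNge => /ltW/(ler_wpM2l (p_ge0 v)); nra.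
  rewrite -(ler_pM2l m_gt0); apply: le_trans (_ : e * (a * eps * m ^+ 2) <= _).
    have -> : m * (2 * eta * m ^+ 3) = eps * m ^+ 2 * (a * eps * m ^+ 2).
      by rewrite /eta; field.
    apply: ler_wpM2r.
      by rewrite ltW // !mulr_gt0 // exprn_gt0.
    by apply: le_trans ep; rewrite ler_wpM2r // exprn_ge0 // ltW.
  have e_ge0 : 0 <= e by exact: wedges_ge0.
  apply: le_trans (_ : e * ((1 + a - eps) * e - m ^+ 2) <= _).
    rewrite ler_wpM2l //.
    have al_ge0 : 0 <= 1 + a - eps by lra.
    have := ler_wpM2l al_ge0 ep.
    have := ler_wpM2r (exprn_ge0 2 (ltW m_gt0)) aD.
    rewrite -/m -/e -mulrA; move: (D) => D0; set al := 1 + a - eps; lra.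
  have := ler_wpM2l (ltW m_gt0) gS.
  have al_ge0 : 0 <= 1 + a - eps by lra.
  have := ler_wpM2l al_ge0 S_ge.
  by rewrite -/m; set al := 1 + a - eps; nra.
(* Links of mass below [eta * m] contribute at most half of [good_sum]. Discarding them allows
   [d v ^+ k] to be bounded below afterwards. *)
have big_sum : eta * m ^+ 3 <=
    \sum_(v | good v && (eta * m <= d v)) p v * d v ^+ 2.
  have small : \sum_(v | good v && ~~ (eta * m <= d v)) p v * d v ^+ 2
      <= eta * m ^+ 3.
    apply: le_trans (_ : \sum_v p v * (eta * m) ^+ 2 <= _).
      rewrite big_mkcond; apply: ler_sum => v _; case: ifP => [|_].
        case/andP=> _; rewrite -ltNge => /ltW dv; rewrite ler_wpM2l //.
        by rewrite lerXn2r // nnegrE // mulr_ge0 // ltW.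
      by rewrite mulr_ge0 // exprn_ge0 // mulr_ge0 // ltW.
    rewrite -mulr_suml -/(mass p) -/m.
    have -> : m * (eta * m) ^+ 2 = eta * (eta * m ^+ 3) by ring.
    by rewrite ler_piMl // mulr_ge0 ?exprn_ge0 // ltW.
  by move: good_sum; rewrite (bigID (fun v => eta * m <= d v)) /=; lra.
apply: le_trans (_ : c * (eta * m) ^+ k *
    (\sum_(v | good v && (eta * m <= d v)) p v * d v ^+ 2) <= _).
  have -> : c * eta ^+ k * eta * m ^+ k.+3
      = c * (eta * m) ^+ k * (eta * m ^+ 3).
    by move: (eta) => x; rewrite exprMn -[k.+3]addn3 exprD; ring.
  by rewrite ler_wpM2l // mulr_ge0 // exprn_ge0 // mulr_ge0 // ltW.
rewrite mulr_sumr big_mkcond; apply: ler_sum => v _.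
case: ifP => [/andP[good_v big_v]|_]; last first.
  by rewrite mulr_ge0 // (@cliques_ge0 k.+2).
rewrite mulrCA ler_wpM2l //; apply: le_trans (IH _ (link0 v) good_v).
rewrite -/(d v) -[k.+2]addn2 exprD mulrA ler_wpM2r ?exprn_ge0 // ler_wpM2l //.
by rewrite lerXn2r // nnegrE // mulr_ge0 // ltW.
Qed.
End Weighted.

(** Induction on [s], applying the hypothesis inside dense links. With [a = s.+1%:R^-1] the
    threshold [(1 + a^-1)^-1] of the step is [s.+2%:R^-1]. *)
Lemma supersaturation (R : realType) (s : nat) (eps : R) : 0 < eps ->
  exists2 c : R, 0 < c & forall (G : sgraph) (p : G -> R), (forall w, 0 <= p w) ->
    (1 - s.+1%:R^-1 + eps) * mass p ^+ 2 <= wedges p ->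
    c * mass p ^+ s.+2 <= cliques s.+2 p.
Proof.
move=> eps_gt0; elim: s => [|s [c c_gt0 IH]].
  exists eps => // G p p_ge0; rewrite invr1 subrr add0r => /le_trans; apply.
  rewrite /wedges /=; apply: ler_sum => v _; rewrite ler_wpM2l //.
  by apply: ler_sum => w _; rewrite mulr1.
pose eta : R := s.+1%:R^-1 * eps ^+ 2 / 2.
have eta_gt0 : 0 < eta by rewrite !mulr_gt0 ?exprn_gt0 ?invr_gt0 ?ltr0n.
exists (c * eta ^+ s * eta) => [|G p p_ge0 ep].
  by rewrite !mulr_gt0 ?exprn_gt0 ?invr_gt0 ?ltr0n.
have := mass_ge0 p_ge0; rewrite le_eqVlt => /orP[/eqP m0|m_gt0].
  by rewrite -m0 exprS mul0r mulr0 cliques_ge0.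
have a_gt0 : 0 < s.+1%:R^-1 :> R by rewrite invr_gt0 ltr0n.
have a_le1 : s.+1%:R^-1 <= 1 :> R by rewrite invf_le1 ?ltr0n // ler1n.
apply: (supersaturation_step p_ge0 m_gt0 a_gt0 a_le1 eps_gt0 (ltW c_gt0)) => //.
  exact: IH.
by rewrite invrK nat1r.
Qed.

Lemma subset_of_card (T : finType) (A : {set T}) n : (n <= #|A|)%N ->
  exists2 B : {set T}, B \subset A & #|B| = n.
Proof.
move=> nA; exists [set x in take n (enum A)].
  by apply/fintype.subsetP=> x; rewrite inE => /mem_take; rewrite mem_enum.
rewrite cardsE; move/card_uniqP: (take_uniq n (enum_uniq A)) => ->.
by rewrite size_takel // -cardE.
Qed.

(** * Weighted integrals over tuples and boxes inside dense sets of tuples *)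

Section Box.
Context {R : realType} {V : finType}.
Implicit Types (p : V -> R) (f g : seq V -> R).

Fixpoint integ p k f : R :=
  if k is k'.+1 then \sum_v p v * integ p k' (fun Q => f (v :: Q)) else f [::].

Lemma eq_integ p k f g : f =1 g -> integ p k f = integ p k g.
Proof.
elim: k f g => /= [|k IH] f g fg; first exact: fg.
by apply: eq_bigr => v _; congr (_ * _); apply: IH => Q; exact: fg.
Qed.

Lemma ler_integ p k f g : (forall v, 0 <= p v) -> (forall Q, f Q <= g Q) ->
  integ p k f <= integ p k g.
Proof.
move=> p_ge0; elim: k f g => //= k IH f g fg.
by apply: ler_sum => v _; rewrite ler_wpM2l // IH.
Qed.

Lemma integ_sum p k (I : finType) (P : pred I) (F : I -> seq V -> R) :
  integ p k (fun Q => \sum_(i | P i) F i Q) = \sum_(i | P i) integ p k (F i).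
Proof.
elim: k F => //= k IH F; rewrite exchange_big /=; apply: eq_bigr => v _.
by rewrite IH mulr_sumr.
Qed.

Lemma integD p k f g :
  integ p k (fun Q => f Q + g Q) = integ p k f + integ p k g.
Proof.
elim: k f g => //= k IH f g; rewrite -big_split; apply: eq_bigr => v _ /=.
by rewrite IH mulrDr.
Qed.

Lemma integZ p k a f : integ p k (fun Q => a * f Q) = a * integ p k f.
Proof.
elim: k f => //= k IH f; rewrite mulr_sumr; apply: eq_bigr => v _.
by rewrite IH mulrCA.
Qed.

Lemma integ_cst_le p k a : (forall v, 0 <= p v) -> \sum_v p v <= 1 -> 0 <= a ->
  integ p k (fun=> a) <= a.
Proof.
move=> p_ge0 p_le1 a_ge0; elim: k => //= k IH.
apply: le_trans (_ : \sum_v p v * a <= _).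
  by apply: ler_sum => v _; rewrite ler_wpM2l.
by rewrite -mulr_suml ler_piMl.
Qed.

(** For each [Q], either fewer than [t] vertices of [Z] satisfy [g v Q], or some [t]-subset of [Z]
    does so entirely. Integrating over [Q], with at most [2 ^ #|Z|] subsets available, one of them
    must have integral at least [beta]. *)
Lemma integ_pigeonhole p k t (b beta : R) (Z : {set V}) (g : V -> pred (seq V)) :
  (forall v, 0 <= p v) -> \sum_v p v <= 1 ->
  (forall v, v \in Z -> b <= integ p k (fun Q => (g v Q)%:R)) ->
  t%:R + #|Z|%:R * (2 ^ #|Z|)%:R * beta < #|Z|%:R * b -> 0 <= beta ->
  exists T : {set V}, [/\ T \subset Z, #|T| = t &
    beta <= integ p k (fun Q => [forall v in T, g v Q]%:R)].
Proof.
move=> p_ge0 p_le1 gb big_b beta_ge0; apply: contrapT => noT.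
suff : #|Z|%:R * b <= t%:R + #|Z|%:R * (2 ^ #|Z|)%:R * beta by rewrite leNgt big_b.
pose D := [set T in powerset Z | #|T| == t].
have pointwise Q : \sum_(v in Z) (g v Q)%:R
    <= t%:R + #|Z|%:R * \sum_(T in D) [forall v in T, g v Q]%:R :> R.
  pose A := [set v in Z | g v Q].
  have -> : \sum_(v in Z) (g v Q)%:R = #|A|%:R :> R.
    rewrite -sum1_card natr_sum big_mkcond [RHS]big_mkcond /=.
    by apply: eq_bigr => v _; rewrite inE; case: (v \in Z); case: (g v Q).
  have [tA|/ltnW tA] := leqP t #|A|; last first.
    by rewrite (le_trans (_ : _ <= t%:R)) ?ler_nat // lerDl mulr_ge0 ?sumr_ge0.
  have [T TA Tt] := subset_of_card tA.
  apply: le_trans (_ : #|Z|%:R * 1 <= _).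
    rewrite mulr1 ler_nat subset_leq_card //.
    by apply/fintype.subsetP=> v; rewrite inE => /andP[].
  rewrite (le_trans (_ : _ <=
    #|Z|%:R * \sum_(T in D) [forall v in T, g v Q]%:R)) ?lerDr //.
  have TD : T \in D.
    rewrite inE powersetE Tt eqxx andbT (fintype.subset_trans TA) //.
    by apply/fintype.subsetP=> v; rewrite inE => /andP[].
  rewrite ler_wpM2l // (bigD1 T TD) /=.
  have -> : [forall v in T, g v Q].
    by apply/forall_inP=> v /(fintype.subsetP TA); rewrite inE => /andP[].
  by rewrite lerDl sumr_ge0.
apply: le_trans (_ : \sum_(v in Z) integ p k (fun Q => (g v Q)%:R) <= _).
  rewrite -sum1_card natr_sum mulr_suml; apply: ler_sum => v vZ.
  by rewrite mul1r gb.
rewrite -integ_sum; apply: le_trans (ler_integ _ p_ge0 pointwise) _.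
rewrite integD integZ integ_sum lerD ?integ_cst_le // -mulrA ler_wpM2l //.
apply: le_trans (_ : \sum_(T in D) beta <= _).
  apply: ler_sum => T; rewrite inE powersetE => /andP[TZ /eqP Tt].
  rewrite leNgt; apply/negP => /ltW bT; apply: noT; exists T; split=> //.
rewrite sumr_const -[leLHS]mulr_natl ler_wpM2r // ler_nat -card_powerset.
by apply: subset_leq_card; apply/fintype.subsetP=> T; rewrite inE => /andP[].
Qed.
End Box.

(** A weighted form of Erdos's theorem on complete [k]-partite hypergraphs. Many first coordinates
    have large sections; by pigeonhole [t] of them share a set of tails of positive measure, to
    which the induction hypothesis applies. *)
Lemma box_of_integ (R : realType) (k t : nat) (c : R) : 0 < c ->
  exists2 delta : R, 0 < delta &
  forall (V : finType) (p : V -> R) (h : pred (seq V)),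
    (forall v, 0 <= p v <= delta) -> \sum_v p v <= 1 ->
    c <= integ p k (fun Q => (h Q)%:R) ->
    exists P : nat -> {set V},
      (forall i, (i < k)%N -> #|P i| = t /\ forall v, v \in P i -> 0 < p v) /\
      forall Q, size Q = k ->
        (forall i x0, (i < k)%N -> nth x0 Q i \in P i) -> h Q.
Proof.
elim: k c => [|k IH] c c_gt0.
  exists 1 => // V p h _ _ /= ch; exists (fun=> finset.set0).
  split=> // Q /size0nil -> _.
  by case: (h [::]) ch => //; rewrite leNgt c_gt0.
(* This makes [t + N * (c / 4) < N * (c / 2)], the pigeonhole hypothesis for [N] vertices and
   [beta = c']. *)
have [N N_gt] : exists N : nat, 4 * t.+1%:R / c < N%:R :> R.
  by exists (Num.truncn (4 * t.+1%:R / c)).+1; rewrite truncnS_gt.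
have N_gt0 : (0 < N)%N.
  rewrite -(ltr_nat R) (le_lt_trans _ N_gt) //; apply: divr_ge0; last exact: ltW.
  exact: mulr_ge0.
pose c' := c / 4 / (2 ^ N)%:R.
have c'_gt0 : 0 < c' by rewrite !divr_gt0 // ltr0n expn_gt0.
have [delta' delta'_gt0 IHc] := IH c' c'_gt0.
exists (Num.min delta' (c / 2 / N%:R)).
  by rewrite lt_min delta'_gt0 !divr_gt0 // ltr0n.
move=> V p h p_bd p_le1 ch.
have p_ge0 v : 0 <= p v by have /andP[] := p_bd v.
pose g v : pred (seq V) := fun Q => h (v :: Q).
pose J v := integ p k (fun Q => (g v Q)%:R).
have J_le1 v : J v <= 1.
  apply: le_trans (integ_cst_le k p_ge0 p_le1 ler01).
  by apply: ler_integ => // Q; rewrite lern1 leq_b1.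
pose Z := [set v | (0 < p v) && (c / 2 <= J v)].
(* [Z] has mass at least [c / 2] while each vertex weighs at most [c / 2 / N]. *)
have Z_ge : (N <= #|Z|)%N.
  have pZ : c / 2 <= \sum_(v in Z) p v.
    have : c <= \sum_(v in Z) p v + \sum_v p v * (c / 2).
      apply: le_trans ch _; rewrite /= [X in _ <= X + _]big_mkcond -big_split /=.
      apply: ler_sum => v _; rewrite inE -/(J v).
      have [/andP[_ _]|] := boolP ((0 < p v) && _).
        rewrite -[leLHS]addr0; apply: lerD; first by rewrite ler_piMr.
        by rewrite mulr_ge0 // ltW // divr_gt0.
      rewrite negb_and -leNgt -ltNge add0r => /orP[pv|/ltW Jv].
        by have/le_anti -> : p v <= 0 <= p v; rewrite ?pv ?p_ge0 // !mul0r.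
      by rewrite ler_wpM2l.
    rewrite -mulr_suml => c_le.
    have : (\sum_v p v) * (c / 2) <= c / 2 by rewrite ler_piMl // divr_ge0 // ltW.
    lra.
  have : \sum_(v in Z) p v <= #|Z|%:R * (c / 2 / N%:R).
    rewrite -sum1_card natr_sum mulr_suml; apply: ler_sum => v _.
    by rewrite mul1r; have /andP[_] := p_bd v; rewrite le_min => /andP[].
  move/(le_trans pZ); rewrite mulrA ler_pdivlMr ?ltr0n // [leLHS]mulrC.
  by rewrite ler_pM2r ?ler_nat // divr_gt0.
have [Z' Z'Z Z'N] := subset_of_card Z_ge.
have [|||T [TZ Tt Tc]] := @integ_pigeonhole R V p k t (c / 2) c' Z' g p_ge0 p_le1.
- by move=> v /(fintype.subsetP Z'Z); rewrite inE => /andP[].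
- rewrite Z'N -mulrA /c' [X in _ * X]mulrC divfK; last first.
    by rewrite pnatr_eq0 -lt0n expn_gt0.
  by move: N_gt; rewrite ltr_pdivrMr // -[t.+1%:R]natr1; lra.
- exact: ltW.
have [v|P [Pk PQ]] := IHc V p (fun Q => [forall v in T, g v Q]) _ p_le1 Tc.
  by have := p_bd v; rewrite le_min => /and3P[-> ->].
exists (fun i => if i is i'.+1 then P i' else T); split=> [[|i] ik|[|v Q] //= [Qk] QP].
- split=> // v /(fintype.subsetP TZ)/(fintype.subsetP Z'Z).
  by rewrite inE => /andP[].
- exact: Pk.
have /forall_inP := PQ Q Qk (fun i x0 ik => QP i.+1 x0 ik).
by apply; exact: (QP 0 v).
Qed.

(** Edges inside a part are allowed. Disjointness of the parts follows from irreflexivity of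
    [adj]. *)
Definition complete_multipartite (G : sgraph) (k t : nat) (P : nat -> {set G}) :=
  (forall i, (i < k)%N -> #|P i| = t) /\
  forall i j u w, (i < k)%N -> (j < k)%N -> i != j -> u \in P i -> w \in P j ->
    adj u w.

Lemma integ_link (R : realType) (G : sgraph) (p : G -> R) v k f :
  integ (link p v) k f = integ p k (fun Q => (all (adj v) Q)%:R * f Q).
Proof.
elim: k f => /= [|k IH] f; first by rewrite mul1r.
apply: eq_bigr => w _; rewrite IH /link -mulrA -integZ; congr (_ * _).
by apply: eq_integ => Q /=; rewrite mulrA -natrM mulnb.
Qed.

Lemma cliquesE (R : realType) (G : sgraph) (p : G -> R) k :
  cliques k p = integ p k (fun Q => (pairwise (@adj G) Q)%:R).
Proof.
elim: k p => //= k IH p; apply: eq_bigr => v _; congr (_ * _).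
by rewrite IH integ_link; apply: eq_integ => Q; rewrite -natrM mulnb.
Qed.

(** Supersaturation gives the set of ordered cliques positive measure, and a box inside that set is
    a complete multipartite graph. Positivity of [p] on the parts lets a weight supported on a
    chosen set confine the parts to it. *)
Lemma erdos_stone (R : realType) (s t : nat) (eps : R) : (0 < t)%N -> 0 < eps ->
  exists2 delta : R, 0 < delta & forall (G : sgraph) (p : G -> R),
    (forall v, 0 <= p v <= delta) -> mass p <= 1 ->
    1 - s.+1%:R^-1 + eps <= wedges p ->
    exists P : nat -> {set G}, complete_multipartite s.+2 t P /\
      forall i v, (i < s.+2)%N -> v \in P i -> 0 < p v.
Proof.
move=> t_gt0 eps_gt0; have [c c_gt0 cliques_ge] := supersaturation s eps_gt0.
have c'_gt0 : 0 < c * eps ^+ s.+2 by rewrite mulr_gt0 // exprn_gt0.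
have [delta delta_gt0 box] := box_of_integ s.+2 t c'_gt0.
exists delta => // G p p_bd p_le1 ep.
have p_ge0 v : 0 <= p v by have /andP[] := p_bd v.
have D_ge0 : 0 <= 1 - s.+1%:R^-1 :> R by rewrite subr_ge0 invf_le1 ?ler1n ?ltr0n.
have m_ge0 := mass_ge0 p_ge0.
have m_ge : eps <= mass p.
  apply: le_trans (_ : mass p ^+ 2 <= _); last by rewrite expr2 ler_piMl.
  by apply: le_trans (wedges_le p_ge0); apply: le_trans ep; rewrite lerDr.
have [|P [Pk PQ]] := box G p (pairwise (@adj G)) p_bd p_le1.
  rewrite -cliquesE; apply: le_trans (cliques_ge _ _ p_ge0 _).
    by rewrite ler_wpM2l ?(ltW c_gt0) // lerXn2r ?nnegrE // ltW.
  by apply: le_trans ep; apply: ler_piMr; rewrite ?exprn_ile1 // addr_ge0 // ltW.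
(* Extend [u] and [w] to a transversal [y] of all the parts, which are nonempty as [t > 0]; the box
   property makes [y] a clique. *)
have adjP i j u w : (i < j < s.+2)%N -> u \in P i -> w \in P j -> adj u w.
  case/andP=> ij js uP wP; have is2 := ltn_trans ij js.
  pose x l := odflt u [pick v in P l].
  have xP l : (l < s.+2)%N -> x l \in P l.
    move=> ls; rewrite /x; case: pickP => //= P0; have [Pl _] := Pk l ls.
    by move: t_gt0; rewrite -Pl card_gt0 => /set0Pn[v]; rewrite P0.
  pose y l := if l == i then u else if l == j then w else x l.
  have yP l : (l < s.+2)%N -> y l \in P l.
    by rewrite /y; have [->//|_] := eqVneq l i; have [->//|_] := eqVneq l j; exact: xP.
  have /(pairwiseP u)/(_ i j) : pairwise (@adj G) (mkseq y s.+2).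
    by apply: PQ => [|l x0 ls]; rewrite ?size_mkseq // nth_mkseq // yP.
  rewrite !inE size_mkseq !nth_mkseq // => /(_ is2 js ij).
  by rewrite /y eqxx eqxx (gtn_eqF ij).
exists P; split; last by move=> i v /Pk[_]; apply.
split=> [i /Pk[]//|i j u w ik jk]; rewrite neq_ltn => /orP[ij|ji] uP wP.
  by apply: (adjP i j) => //; rewrite ij.
by rewrite adj_sym; apply: (adjP j i) => //; rewrite ji.
Qed.

(** * Colourings, Turan graphs and rewiring a vertex *)

Lemma colorable_chromatic_number (F : sgraph) : colorable F (chromatic_number F).
Proof. by rewrite /chromatic_number; case: ex_minnP. Qed.

Lemma chromatic_number_le (F : sgraph) k :
  colorable F k -> (chromatic_number F <= k)%N.
Proof. by rewrite /chromatic_number; case: ex_minnP => m _; exact. Qed.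

Lemma colorable_contains (F G : sgraph) k : contains G F -> colorable G k ->
  colorable F k.
Proof.
case=> f [_ fP] /existsP[c /forallP cP].
apply/existsP; exists [ffun x => c (f x)].
apply/'forall_forallP=> x y; apply/implyP=> xy; rewrite !ffunE.
by have /forallP/(_ (f y))/implyP := cP (f x); apply; exact: fP.
Qed.

Lemma multipartite_contains (F G : sgraph) k t (P : nat -> {set G}) :
  complete_multipartite k t P -> colorable F k -> (#|F| <= t)%N -> contains G F.
Proof.
move=> [Pt Padj] /existsP[c /'forall_forallP cP] Ft.
have [x0 _|F0] := pickP F; last first.
  have empty (x : F) : False by have := F0 x.
  by exists (fun x => match empty x with end); split=> x; have := F0 x.
have F_gt0 : (0 < #|F|)%N by apply/card_gt0P; exists x0.
have : P (c x0) != finset.set0 by rewrite -card_gt0 Pt // (leq_trans F_gt0).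
case/set0Pn=> v0 _.
have rank_lt x : (enum_rank x < #|P (c x)|)%N.
  by rewrite Pt // (leq_trans (ltn_ord _)).
(* Indexing by the rank of [x] in the whole of [F] keeps [f] injective on each colour class and
   stays in range since [#|F| <= t]. *)
pose f x := nth v0 (enum (P (c x))) (enum_rank x).
have fP x : f x \in P (c x) by rewrite -mem_enum mem_nth // -cardE.
have f_adj x y : c x != c y -> adj (f x) (f y).
  move=> cxy; apply: (Padj (c x) (c y)) => //.
exists f; split=> [x y fxy|x y xy]; last first.
  by apply: f_adj; have /implyP := cP x y; apply.
have [cxy|/f_adj] := eqVneq (c x) (c y); last by rewrite fxy adj_irr.
apply/enum_rank_inj/val_inj/eqP => /=.
have := fxy; rewrite /f cxy => /eqP; rewrite nth_uniq ?enum_uniq // -cardE //.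
by rewrite -cxy.
Qed.

Section Turan.
Variables (r n : nat).
Definition turan_adj (i j : 'I_n) := (i %% r != j %% r)%N.
Lemma turan_sym : symmetric turan_adj.
Proof. by move=> i j; rewrite /turan_adj eq_sym. Qed.
Lemma turan_irr : irreflexive turan_adj.
Proof. by move=> i; rewrite /turan_adj eqxx. Qed.
Definition turan := SGraph turan_sym turan_irr.

Lemma turan_colorable : (0 < r)%N -> colorable turan r.
Proof.
move=> r_gt0; apply/existsP.
exists [ffun i : 'I_n => Ordinal (ltn_pmod i r_gt0)].
by apply/'forall_forallP => x y; apply/implyP; rewrite !ffunE.
Qed.

(** Rayleigh quotient of the all-ones vector: a residue class modulo [r] has at most [n / r + 1]
    elements, which bounds every degree from below. *)
Lemma turan_spectral_radius (R : realType) : (0 < r)%N -> (0 < n)%N ->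
  (1 - r%:R^-1) * n%:R - 1 <= spectral_radius R turan.
Proof.
move=> r_gt0 n_gt0.
have n0 : 0 < n%:R :> R by rewrite ltr0n.
have := @spectral_rayleigh R turan (fun=> 1); rewrite card_ord => /(_ n_gt0).
under [X in _ <= _ * X]eq_bigr do rewrite expr1n.
rewrite [X in _ <= _ * X]sumr_const card_ord => rayleigh.
rewrite -(ler_pM2r n0); apply: le_trans rayleigh.
apply: le_trans (_ : \sum_(v : turan) ((1 - r%:R^-1) * n%:R - 1) <= _).
  by rewrite sumr_const card_ord -[leRHS]mulr_natr.
apply: ler_sum => v _; rewrite mul1r sumr_const.
pose A := [pred w : 'I_n | w %% r == v %% r]%N.
have A_le : (#|A| <= (n %/ r).+1)%N.
  pose q (w : 'I_n) : 'I_(n %/ r).+1 := inord (w %/ r).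
  rewrite -[leqRHS]card_ord -(card_in_imset (f := q)).
    exact: max_card.
  move=> w1 w2; rewrite !inE => /eqP w1v /eqP w2v /(congr1 val) /=.
  rewrite !inordK ?ltnS ?leq_div2r 1?ltnW // => q12; apply: val_inj => /=.
  by rewrite (divn_eq w1 r) (divn_eq w2 r) q12 w1v w2v.
have /(congr1 (GRing.natmul (1 : R))) := cardC A; rewrite card_ord natrD.
have -> : #|[predC A]| = #|turan_adj v|.
  by apply: eq_card => w; rewrite !inE /turan_adj eq_sym.
have : #|A|%:R <= n%:R / r%:R + 1 :> R.
  apply: le_trans (_ : ((n %/ r).+1)%:R <= _); first by rewrite ler_nat.
  by rewrite -natr1 lerD2r ler_pdivlMr ?ltr0n // -natrM ler_nat leq_divM.
rewrite mulrBl mul1r [_^-1 * _]mulrC.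
have -> : #|[eta adj (s:=turan) v]| = #|turan_adj v| by [].
lra.
Qed.
End Turan.

Section Clone.
Variables (G : sgraph) (u : G) (S : {set G}).

Definition rewired_adj (v w : G) :=
  if v == u then (w != u) && (w \in S) else if w == u then v \in S else adj v w.
Lemma rewired_sym : symmetric rewired_adj.
Proof.
move=> v w; rewrite /rewired_adj adj_sym.
by case: (v =P u) => _; case: (w =P u).
Qed.
Lemma rewired_irr : irreflexive rewired_adj.
Proof.
by move=> v; rewrite /rewired_adj; case: eqP; rewrite ?adj_irr.
Qed.
Definition rewired := SGraph rewired_sym rewired_irr.

(* A copy of [F] through [u] is repaired by moving [u] to a vertex of [T]
   outside the copy. *)
Lemma contains_rewired (F : sgraph) (T : {set G}) : (#|F|.+1 < #|T|)%N ->
  (forall v w, v \in T -> w \in S -> adj v w) ->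
  contains rewired F -> contains G F.
Proof.
move=> FT TS [f [f_inj fP]].
have [v vT] : exists2 v, v \in T & v \notin u |: [set f x | x : F].
  apply/exists_inP; apply: contraTT FT; rewrite negb_exists_in -leqNgt.
  move=> /forall_inP TU.
  apply: leq_trans (_ : #|u |: [set f x | x : F]| <= _)%N.
    by apply/subset_leq_card/fintype.subsetP=> v /TU; rewrite negbK.
  by rewrite (leq_trans (leq_card_setU _ _)) // cards1 add1n ltnS leq_imset_card.
rewrite !inE negb_or => /andP[vu vf].
have v_neq x : f x != v by apply: contraNneq vf => <-; rewrite imset_f.
exists (fun x => if f x == u then v else f x); split=> [x y|x y /fP].
  have [fxu|_] := eqVneq (f x) u; have [fyu|_] := eqVneq (f y) u.
  - by move=> _; apply: f_inj; rewrite fxu fyu.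
  - by move/esym/eqP; rewrite (negPf (v_neq y)).
  - by move/eqP; rewrite (negPf (v_neq x)).
  - exact: f_inj.
rewrite /= /rewired_adj; have [_|_] := eqVneq (f x) u.
  by case/andP=> /negPf -> fyS; exact: TS.
have [_|_] // := eqVneq (f y) u.
by move=> fxS; rewrite adj_sym; exact: TS.
Qed.

(** Test the rewired graph on [x] with the entry at [u] changed to [z]. The Rayleigh bound becomes
    [2 * s * z - rho * z ^+ 2 <= N * x u], whose left side is [s ^+ 2 / rho], while
    [N * x u <= N ^+ 2 / rho]. *)
Lemma rewired_weight_le (R : realType) (x : G -> R)
    (rho := spectral_radius R G) :
  0 < rho -> spectral_radius R rewired <= rho ->
  (forall v, 0 <= x v) -> (forall v, rho * x v <= \sum_(w | adj v w) x w) ->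
  \sum_(w in S | w != u) x w <= \sum_(w | adj u w) x w.
Proof.
move=> rho_gt0 H_le x_ge0 x_sub.
set s := \sum_(w in S | _) _; set N := \sum_(w | adj u w) x w.
have s_ge0 : 0 <= s by exact: sumr_ge0.
have N_ge0 : 0 <= N by exact: sumr_ge0.
(* The value [z] at [u] maximises [2 z s - rho z ^+ 2]. *)
pose z := s / rho; pose y v := if v == u then z else x v.
have G_gt0 : (0 < #|rewired|)%N by apply/card_gt0P; exists u.
pose q := \sum_(v | v != u) x v ^+ 2.
have yyE : \sum_v y v ^+ 2 = z ^+ 2 + q.
  rewrite (bigD1 u) //= {1}/y eqxx; congr (_ + _).
  by apply: eq_bigr => v /negPf vu; rewrite /y vu.
have y_ge0 : 0 <= z ^+ 2 + q.
  by rewrite addr_ge0 ?sqr_ge0 // sumr_ge0 // => v _; rewrite sqr_ge0.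
have yu : \sum_(w | rewired_adj u w) y w = s.
  rewrite /s; apply: eq_big => w; rewrite /rewired_adj eqxx andbC //.
  by case/andP=> _ /negPf; rewrite /y => ->.
have yv v : v != u -> \sum_(w | rewired_adj v w) y w =
    \sum_(w | adj v w) x w - (adj v u)%:R * x u + (v \in S)%:R * z.
  move=> vu.
  rewrite [LHS]big_mkcond [X in X - _]big_mkcond /= !(bigD1 u (P := predT)) //=.
  rewrite /rewired_adj (negPf vu) eqxx /y eqxx.
  have -> : \sum_(w | w != u) (if (if w == u then v \in S else adj v w)
      then if w == u then z else x w else 0) =
      \sum_(w | w != u) (if adj v w then x w else 0).
    by apply: eq_bigr => w /negPf ->.
  by case: (v \in S); case: (adj v u); rewrite ?mul1r ?mul0r; ring.
have : \sum_(v : G) y v * (\sum_(w : G | rewired_adj v w) y w) <=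
    spectral_radius R rewired * \sum_(v : G) y v ^+ 2 :=
  @spectral_rayleigh R rewired y G_gt0.
rewrite yyE (bigD1 u) //= yu {1}/y eqxx.
move=> /le_trans/(_ (ler_wpM2r y_ge0 H_le)).
have -> : \sum_(v | v != u) y v * (\sum_(w | rewired_adj v w) y w) =
    \sum_(v | v != u) x v * (\sum_(w | adj v w) x w) - N * x u + s * z.
  have -> : N * x u = \sum_(v | v != u) x v * ((adj v u)%:R * x u).
    rewrite /N mulr_suml big_mkcond [RHS]big_mkcond; apply: eq_bigr => v _.
    rewrite adj_sym; have [->|_] := eqVneq v u; first by rewrite adj_irr.
    by case: adj; rewrite ?mul1r // mul0r mulr0.
  have -> : s * z = \sum_(v | v != u) x v * ((v \in S)%:R * z).
    rewrite /s mulr_suml big_mkcondl; apply: eq_bigr => v _.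
    by case: (v \in S); rewrite ?mul1r // mul0r mulr0.
  rewrite -sumrB -big_split; apply: eq_bigr => v vu /=.
  by rewrite yv // /y (negPf vu); ring.
have q_le : rho * q <= \sum_(v | v != u) x v * (\sum_(w | adj v w) x w).
  rewrite mulr_sumr; apply: ler_sum => v _.
  by rewrite expr2 mulrCA ler_wpM2l.
have Nx : rho * (N * x u) <= N ^+ 2 by rewrite mulrCA expr2 ler_wpM2l // x_sub.
have sz : rho * z = s by rewrite /z mulrCA mulfV ?mulr1 // gt_eqF.
rewrite -/rho => main.
have sq : s ^+ 2 <= N ^+ 2.
  apply: le_trans Nx.
  have : s * z <= N * x u.
    have : rho * (z ^+ 2 + q) = s * z + rho * q by rewrite -sz; ring.
    move: main; lra.
  move/(ler_wpM2l (ltW rho_gt0)); apply: le_trans.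
  by rewrite mulrCA sz expr2.
by rewrite -(@ler_pXn2r _ 2) ?nnegrE.
Qed.
End Clone.

Lemma SPEX_weight_le (R : realType) n (I : finType) (F : I -> sgraph) (G : sgraph)
    (x : G -> R) (T : {set G}) (u : G) (rho := spectral_radius R G) :
  SPEX R n F G -> 0 < rho -> (forall i, #|F i|.+1 < #|T|)%N ->
  (forall v, 0 <= x v) -> (forall v, rho * x v <= \sum_(w | adj v w) x w) ->
  \sum_(w | [forall v in T, adj v w] && (w != u)) x w <= \sum_(w | adj u w) x w.
Proof.
case=> Gn Gfree Gmax rho_gt0 FT x_ge0 x_sub.
pose S := [set w | [forall v in T, adj v w]].
have : spectral_radius R (rewired u S) <= rho.
  apply: Gmax => // i /(@contains_rewired G u S (F i) T (FT i)) H.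
  apply/(Gfree i)/H => v w vT; rewrite inE => /forall_inP; exact.
move=> /(rewired_weight_le rho_gt0)/(_ x_ge0 x_sub).
by under eq_bigl do rewrite inE.
Qed.

(** * Large common neighbourhoods *)

Definition nbhd (G : sgraph) (v : G) := [set w : G | adj v w].

Lemma card_fibre_ge (T U : finType) (f : T -> U) (A : {set T}) (B : {set U}) t :
  (forall x, x \in A -> f x \in B) -> (#|B| * t < #|A|)%N ->
  exists2 y, y \in B & (t <= #|[set x in A | f x == y]|)%N.
Proof.
move=> fAB; apply: contraPP => no_y; apply/negP; rewrite -leqNgt.
rewrite -sum1_card (partition_big f (mem B)) //= -sum_nat_const.
apply: leq_sum => y yB; rewrite sum1dep_card leqNgt; apply/negP => /ltnW ty.
by apply: no_y; exists y.
Qed.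

(** Otherwise [t] of these vertices have the same trace [B] on the union of the parts. As [B] meets
    every part in at least [t] vertices, they would serve as an additional part. *)
Lemma few_rich_vertices (G : sgraph) r t M (P : nat -> {set G}) :
  complete_multipartite r M P ->
  (forall P', ~ @complete_multipartite G r.+1 t P') ->
  (#|[set w | [forall i : 'I_r, t <= #|P i :&: nbhd w|]]| <= 2 ^ (r * M) * t)%N.
Proof.
move=> [PM Padj] noP'; rewrite leqNgt; apply/negP; set A := [set w | _] => A_gt.
pose U := \bigcup_(i < r) P i.
have UrM : (#|U| <= r * M)%N.
  apply: leq_trans (_ : \sum_(i < r) #|P i| <= _)%N.
    rewrite /U; elim/big_rec2: _ => [|i m B _ mB]; first by rewrite cards0.
    by rewrite (leq_trans (leq_card_setU _ _)) // leq_add2l.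
  by rewrite (eq_bigr (fun=> M)) ?sum_nat_const ?card_ord // => i _; apply: PM.
have [w _||B BU tB] := @card_fibre_ge _ _ (fun w => U :&: nbhd w) A (powerset U) t.
- by rewrite powersetE subsetIl.
- by apply: leq_ltn_trans A_gt; rewrite leq_mul2r card_powerset leq_pexp2l ?orbT.
set Z := [set _ in _ | _] in tB.
pose X i := if i == r then Z else P i :&: B.
have adjX i j u w : (i < r)%N -> (j < r.+1)%N -> i != j ->
    u \in X i -> w \in X j -> adj u w.
  move=> ir; rewrite ltnS leq_eqVlt /X (ltn_eqF ir) => /orP[/eqP->|jr] ij;
    rewrite ?eqxx.
    rewrite !inE => /andP[uP uB] /andP[_ /eqP BE].
    by move: uB; rewrite -BE !inE adj_sym => /andP[].
  rewrite (ltn_eqF jr) !inE => /andP[uP _] /andP[wP _]; exact: (Padj i j).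
have X_ge i : exists Y : {set G}, (i < r.+1)%N -> Y \subset X i /\ #|Y| = t.
  have [ir|_] := boolP (i < r.+1)%N; last by exists finset.set0.
  suff /subset_of_card[Y YX Yt] : (t <= #|X i|)%N by exists Y.
  move: ir; rewrite ltnS leq_eqVlt /X => /orP[/eqP->|ir]; first by rewrite eqxx.
  rewrite (ltn_eqF ir).
  have [->|t_gt0] := posnP t; first by [].
  have : (0 < #|Z|)%N by exact: leq_trans tB.
  case/card_gt0P=> w; rewrite !inE => /andP[/forallP/(_ (Ordinal ir)) /= tw /eqP <-].
  apply: leq_trans tw _; apply/subset_leq_card/fintype.subsetP => v.
  rewrite !inE => /andP[vP ->]; rewrite vP andbT /=.
  by apply/bigcupP; exists (Ordinal ir).
have [Y YP] := choice X_ge; apply: (noP' Y); split=> [i /YP[]//|i j u w ir jr ij].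
have [/fintype.subsetP YX _] := YP i ir; have [/fintype.subsetP YX' _] := YP j jr.
move=> /YX uX /YX' wX.
have := ir; rewrite ltnS leq_eqVlt => /orP[/eqP iE|]; last first.
  by move=> ir'; apply: (adjX i j).
rewrite adj_sym; apply: (adjX j i) => //; last by rewrite eq_sym.
by move: jr; rewrite ltnS leq_eqVlt -iE eq_sym (negPf ij).
Qed.

Lemma exists_natr_gt (R : realType) (x : R) : exists N : nat, x < N%:R.
Proof. by exists (Num.truncn x).+1; rewrite truncnS_gt. Qed.

Lemma exists_le_mean (R : realType) r (f : 'I_r -> R) (c : R) : (0 < r)%N ->
  \sum_i f i <= c -> exists i, r%:R * f i <= c.
Proof.
move=> r_gt0 fc; apply: contrapT => nof.
have lt_f i : c < r%:R * f i by rewrite ltNge; apply/negP => fi; apply: nof; exists i.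
have r0 : 0 < r%:R :> R by rewrite ltr0n.
have : r%:R * c < r%:R * \sum_i f i.
  rewrite mulr_sumr; apply: le_lt_trans (_ : \sum_(i < r) c < _).
    by rewrite sumr_const card_ord mulr_natl.
  apply: ltr_sum => //; case: r r_gt0 {f fc nof lt_f r0} => // r' _.
  by apply/hasP; exists ord0; rewrite ?mem_index_enum.
by rewrite ltr_pM2l // ltNge fc.
Qed.

Lemma sum_nonadjacent (R : realType) (G : sgraph) (A B : {set G}) :
  \sum_(v in A) \sum_(w in B) (~~ adj v w)%:R =
  \sum_(w in B) #|[set v in A | ~~ adj v w]|%:R :> R.
Proof.
rewrite exchange_big; apply: eq_bigr => w _ /=.
rewrite -sum1_card natr_sum big_mkcond [RHS]big_mkcond.
by apply: eq_bigr => v _; rewrite inE; case: (v \in A); case: adj.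
Qed.

Lemma common_nbhd (R : realType) (G : sgraph) r t M (P : nat -> {set G})
    (kappa : R) (n := #|G|%:R : R) :
  (0 < r)%N -> (0 < t)%N -> 0 < kappa -> 2 * kappa <= 1 ->
  t%:R <= kappa * M%:R -> (2 ^ (r * M) * t)%:R <= kappa * n ->
  complete_multipartite r M P ->
  (forall P', ~ @complete_multipartite G r.+1 t P') ->
  (forall i v, (i < r)%N -> v \in P i ->
    (1 - r%:R^-1 - kappa / r%:R) * n <= (degree v)%:R) ->
  exists2 T : {set G}, #|T| = t &
    (1 - r%:R^-1 - 4 * kappa - 6 * t%:R * kappa) * n
      <= #|[set w | [forall v in T, adj v w]]|%:R.
Proof.
move=> r_gt0 t_gt0 k_gt0 k_le1 tM Mn PP noP' degP.
have r0 : 0 < r%:R :> R by rewrite ltr0n.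
have n_ge0 : 0 <= n by exact: ler0n.
have t0 : 1 <= t%:R :> R by rewrite ler1n.
have M0 : 0 < M%:R :> R by rewrite -(pmulr_rgt0 _ k_gt0); lra.
have tM2 : 2 * t%:R <= M%:R :> R by nra.
have PM := PP.1.
pose miss i w := #|[set v in P i | ~~ adj v w]|%:R : R.
have miss_ge0 i w : 0 <= miss i w by exact: ler0n.
(* The vertices that behave as members of class [i]: they miss almost all of [P i]. Only [bad]
   vertices lie in no [V i]. *)
pose V (i : 'I_r) := [set w | #|P i :&: nbhd w| < t]%N.
pose bad := [set w : G | [forall i : 'I_r, t <= #|P i :&: nbhd w|]%N].
have bad_le : #|bad|%:R <= kappa * n.
  by apply: le_trans Mn; rewrite ler_nat; exact: few_rich_vertices noP'.
have missE (i : 'I_r) w : miss i w = M%:R - #|P i :&: nbhd w|%:R.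
  rewrite -(PM i (ltn_ord i)) -(cardsID (nbhd w)) natrD addrC addKr.
  rewrite /miss; congr (_%:R); apply: eq_card => v.
  by rewrite !inE andbC adj_sym.
have miss_sum (i : 'I_r) : \sum_w miss i w <= M%:R * (r%:R^-1 + kappa / r%:R) * n.
  have := sum_nonadjacent R (P i) [set: G]; under [RHS]eq_bigl do rewrite inE.
  rewrite /miss => <-; rewrite -(PM i (ltn_ord i)) -sum1_card natr_sum -mulrA mulr_suml.
  apply: ler_sum => v vP; rewrite mul1r.
  have := degP i v (ltn_ord i) vP; rewrite /degree.
  have /(congr1 (GRing.natmul (1 : R))) := cardsC [set y | adj v y]; rewrite natrD -/n.
  have -> : \sum_(w in [set: G]) (~~ adj v w)%:R = #|~: [set y | adj v y]|%:R :> R.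
    rewrite -sum1_card natr_sum [RHS]big_mkcond; apply: eq_big => w; rewrite !inE //.
    by case: adj.
  move=> nE; nra.
have V_ge (i : 'I_r) w : w \in V i -> M%:R - t%:R <= miss i w.
  by rewrite inE missE => /ltnW; rewrite -(ler_nat R); lra.
have cover : n - kappa * n <= \sum_i #|V i|%:R.
  have : (#|G| <= #|bad| + \sum_i #|V i|)%N.
    rewrite -cardsT; apply: leq_trans (_ : #|bad :|: \bigcup_i V i| <= _)%N.
      apply/subset_leq_card/fintype.subsetP => w _; rewrite finset.in_setU.
      have [//|] := boolP (w \in bad); rewrite inE negb_forall => /existsP[i iw].
      by apply/bigcupP; exists i; rewrite // inE ltnNge.
    apply: leq_trans (leq_card_setU _ _) _; rewrite leq_add2l.
    elim/big_rec2: _ => [|i m B _ mB]; first by rewrite cards0.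
    by rewrite (leq_trans (leq_card_setU _ _)) // leq_add2l.
  rewrite -(ler_nat R) natrD natr_sum -/n; lra.
have missV (i : 'I_r) : (M%:R - t%:R) * #|V i|%:R <= \sum_(w in V i) miss i w.
  rewrite mulrC -sum1_card natr_sum mulr_suml; apply: ler_sum => w wV.
  by rewrite mul1r V_ge.
have total : \sum_(i < r) \sum_w miss i w <= M%:R * (1 + kappa) * n.
  apply: le_trans (_ : \sum_(i < r) (M%:R * (r%:R^-1 + kappa / r%:R) * n) <= _).
    by apply: ler_sum => i _; exact: miss_sum.
  rewrite sumr_const card_ord -[leLHS]mulr_natl le_eqVlt; apply/orP; left; apply/eqP.
  by field; rewrite gt_eqF.
(* All missing pairs number at most [M * (1 + kappa) * n]. Those with [w] in [V i] already account
   for [(M - t) * (1 - kappa) * n], and [t <= kappa * M]. *)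
have out_total :
    \sum_(i < r) \sum_(w | w \notin V i) miss i w <= 3 * kappa * M%:R * n.
  have split : \sum_(i < r) \sum_w miss i w =
     \sum_(i < r) \sum_(w in V i) miss i w +
     \sum_(i < r) \sum_(w | w \notin V i) miss i w.
    by rewrite -big_split; apply: eq_bigr => i _; rewrite (bigID (mem (V i))).
  have inV : (M%:R - t%:R) * (n - kappa * n) <= \sum_(i < r) \sum_(w in V i) miss i w.
    apply: le_trans (_ : \sum_(i < r) (M%:R - t%:R) * #|V i|%:R <= _).
      by rewrite -mulr_sumr ler_wpM2l //; lra.
    by apply: ler_sum => i _.
  have := ler_wpM2r n_ge0 tM.
  have : 0 <= t%:R * (kappa * n) :> R by rewrite !mulr_ge0 ?ler0n // ltW.
  nra.
have [i Vi] : exists i : 'I_r, r%:R * #|V i|%:R <= (1 + 4 * kappa) * n.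
  apply: exists_le_mean => //.
  have Vsum : (M%:R - t%:R) * \sum_i #|V i|%:R <= M%:R * (1 + kappa) * n.
    apply: le_trans total; rewrite mulr_sumr; apply: ler_sum => i _.
    apply: le_trans (missV i) _; rewrite [leRHS](bigID (mem (V i))) /= lerDl.
    by apply: sumr_ge0.
  have Mt : 0 < M%:R - t%:R :> R by lra.
  rewrite -(ler_pM2l Mt); apply: le_trans Vsum _.
  rewrite mulrA ler_wpM2r //.
  have : 0 <= 2 * kappa * (1 - 2 * kappa) * M%:R by rewrite !mulr_ge0 ?subr_ge0 // ltW.
  have := ler_wpM2r (_ : 0 <= 1 + 4 * kappa) tM; nra.
pose out v := \sum_(w | w \notin V i) (~~ adj v w)%:R : R.
have out_ge0 v : 0 <= out v by exact: sumr_ge0.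
have out_sum : \sum_(v in P i) out v <= 3 * kappa * M%:R * n.
  apply: le_trans out_total.
  rewrite (bigD1 i) //= -[leLHS]addr0; apply: lerD; last first.
    by apply: sumr_ge0 => j _; apply: sumr_ge0.
  have := sum_nonadjacent R (P i) (~: V i).
  under [RHS]eq_bigl do rewrite inE.
  under [X in X = _]eq_bigr => v _ do under eq_bigl do rewrite inE.
  by move=> ->.
have [i_lt n_gt0] : (i < r)%N /\ 0 < n.
  split=> //; rewrite /n ltr0n.
  have : (0 < #|P i|)%N by rewrite (PM i (ltn_ord i)) -(ltr_nat R).
  by move/leq_trans; apply; exact: max_card.
(* Markov's inequality: the threshold is twice the mean bound for [out], so [L] contains at least
   [M / 2 >= t] vertices. *)
pose L := [set v in P i | out v <= 6 * kappa * n].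
have L_ge : (t <= #|L|)%N.
  have out_L : (M%:R - #|L|%:R) * (6 * kappa * n) <= \sum_(v in P i) out v.
    rewrite -(PM i i_lt) -(cardsID L) natrD.
    have -> : P i :&: L = L.
      by apply/finset.setP=> v; rewrite !inE andbA andbb.
    rewrite [X in X * _]addrAC subrr add0r -sum1_card natr_sum mulr_suml.
    rewrite big_mkcond [leRHS]big_mkcond; apply: ler_sum => v _; rewrite !inE.
    case: (v \in P i) => //=; rewrite andbT -ltNge mul1r.
    by case: ltP => // /ltW.
  have kn : 0 < 6 * kappa * n by rewrite !mulr_gt0.
  have : (M%:R - #|L|%:R) * (6 * kappa * n) <= M%:R / 2 * (6 * kappa * n).
    by apply: le_trans (le_trans out_L out_sum) _; lra.
  rewrite ler_pM2r // -(ler_nat R); lra.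
have [T TL Tt] := subset_of_card L_ge; exists T => //.
set C := [set w | _].
(* A vertex outside [C] and [V i] is missed by some [v] in [T], hence counted in [out v]. *)
have C_ge : n <= #|C|%:R + #|V i|%:R + \sum_(v in T) out v.
  rewrite /out exchange_big /= /n -sum1_card natr_sum -!sum1_card !natr_sum.
  rewrite [X in X + _ + _]big_mkcond [X in _ + X + _]big_mkcond.
  rewrite [X in _ + _ + X]big_mkcond -!big_split /=; apply: ler_sum => w _.
  have S_ge0 : 0 <= \sum_(v in T) (~~ adj v w)%:R :> R by exact: sumr_ge0.
  have [wV|wV] := boolP (w \in V i); first by rewrite addr0; case: ifP => _; lra.
  have [wC|] := boolP (w \in C); first by rewrite /=; lra.
  rewrite inE negb_forall_in => /exists_inP[v vT vw].
  by rewrite /= !add0r (bigD1 v vT) /= vw lerDl sumr_ge0.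
have T_out : \sum_(v in T) out v <= t%:R * (6 * kappa * n).
  rewrite -Tt -sum1_card natr_sum mulr_suml; apply: ler_sum => v.
  by move/(fintype.subsetP TL); rewrite inE mul1r => /andP[].
have V_le : #|V i|%:R <= (r%:R^-1 + 4 * kappa) * n.
  rewrite -(ler_pM2l r0); apply: le_trans Vi _.
  rewrite mulrA mulrDr mulfV ?gt_eqF // ler_wpM2r // lerD2l.
  by rewrite ler_peMl ?ler1n // mulr_ge0 // ltW.
lra.
Qed.

(** * Extremal graphs *)

Lemma wedgesE (R : realType) (G : sgraph) (p : G -> R) :
  wedges p = \sum_v p v * \sum_(w | adj v w) p w.
Proof.
apply: eq_bigr => v _; congr (_ * _); rewrite [RHS]big_mkcond.
by apply: eq_bigr => w _; rewrite /link; case: adj; rewrite ?mulr1 ?mulr0.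
Qed.

Lemma wedgesZ (R : realType) (G : sgraph) (p : G -> R) a :
  wedges (fun v => a * p v) = a ^+ 2 * wedges p.
Proof.
rewrite !wedgesE mulr_sumr; apply: eq_bigr => v _.
by rewrite -mulr_sumr; ring.
Qed.

Lemma multipartite_free_wedges_le (R : realType) (r t : nat) (eps : R) :
  (0 < r)%N -> (0 < t)%N -> 0 < eps ->
  exists2 delta : R, 0 < delta & forall (G : sgraph) (p : G -> R),
    (forall P, ~ @complete_multipartite G r.+1 t P) ->
    (forall v, 0 <= p v <= delta) -> mass p <= 1 ->
    wedges p <= 1 - r%:R^-1 + eps.
Proof.
case: r => // r _ t_gt0 eps_gt0.
have [delta delta_gt0 ES] := @erdos_stone R r t eps t_gt0 eps_gt0.
exists delta => // G p noP p_bd p_le1; rewrite leNgt; apply/negP => /ltW ep.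
by have [P [PP _]] := ES G p p_bd p_le1 ep; exact: (noP P).
Qed.

Lemma sum_near_card (R : realType) (T : finType) (x : T -> R) (P : pred T)
    (eta c : R) : 0 < eta -> \sum_v (x v - 1) ^+ 2 <= eta ^+ 2 * c ->
  #|T|%:R <= c -> `| \sum_(v | P v) x v - #|P|%:R | <= eta * c.
Proof.
move=> eta_gt0 x_near Tc.
have -> : \sum_(v | P v) x v - #|P|%:R = \sum_(v | P v) (x v - 1).
  by rewrite sumrB sumr_const.
apply: le_trans (ler_norm_sum _ _ _) _.
apply: le_trans (_ : \sum_v ((x v - 1) ^+ 2 / (2 * eta) + eta / 2) <= _).
  rewrite big_mkcond; apply: ler_sum => v _.
  (* The AM-GM inequality, which replaces Cauchy-Schwarz after summation. *)
  have key : `|x v - 1| <= (x v - 1) ^+ 2 / (2 * eta) + eta / 2.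
    have -> : (x v - 1) ^+ 2 / (2 * eta) + eta / 2 =
        (`|x v - 1| ^+ 2 + eta ^+ 2) / (2 * eta).
      by rewrite real_normK ?num_real //; field; rewrite gt_eqF.
    rewrite ler_pdivlMr ?mulr_gt0 //.
    have : 0 <= (`|x v - 1| - eta) ^+ 2 by exact: sqr_ge0.
    lra.
  by case: ifP => // _; exact: le_trans key.
rewrite big_split /= -mulr_suml sumr_const -[X in _ + X]mulr_natl.
have e_ge0 : 0 <= eta / 2 by rewrite divr_ge0 // ltW.
have := ler_wpM2r e_ge0 Tc.
have : (\sum_v (x v - 1) ^+ 2) / (2 * eta) <= eta * c / 2.
  by rewrite ler_pdivrMr ?mulr_gt0 // -mulrA; lra.
have -> : #|xpredT : pred T| = #|T| by [].
lra.
Qed.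

Section Extremal.
Context {R : realType} {I : finType} (F : I -> sgraph) (r : nat).
Hypothesis (r_gt1 : (1 < r)%N) (hF : family_min_chromatic F r.+1).

(** Large enough both to embed every [F i] into parts of size [t] and to spare a vertex of a [t]-set
    besides a copy of [F i] and [u]. *)
Let t := (\max_i #|F i|).+2.

Let F_lt_t i : (#|F i|.+1 < t)%N.
Proof. by rewrite !ltnS (leq_bigmax i). Qed.

Let r0 : 0 < r%:R :> R. Proof. by rewrite ltr0n ltnW. Qed.
Let rV_gt0 : 0 < r%:R^-1 :> R. Proof. by rewrite invr_gt0. Qed.
Let rV_le : r%:R^-1 <= 2^-1 :> R.
Proof. by rewrite lef_pV2 ?posrE // ler_nat. Qed.

Lemma SPEX_multipartite_free n G P : SPEX R n F G ->
  ~ @complete_multipartite G r.+1 t P.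
Proof.
case=> _ Gfree _ PP; have [[i Fi] _] := hF; apply: (Gfree i).
apply: (multipartite_contains PP); last by rewrite ltnW // ltnW.
by rewrite -Fi; exact: colorable_chromatic_number.
Qed.

(** The [r]-partite Turan graph is a competitor, since every [F i] has chromatic number above
    [r]. *)
Lemma SPEX_spectral_radius_ge n G : (0 < n)%N -> SPEX R n F G ->
  (1 - r%:R^-1) * n%:R - 1 <= spectral_radius R G.
Proof.
move=> n_gt0 [_ _ Gmax]; have := turan_spectral_radius R (ltnW r_gt1) n_gt0.
move/le_trans; apply; apply: Gmax => [|i Fi]; first by rewrite card_ord.
have := colorable_contains Fi (turan_colorable n (ltnW r_gt1)).
by move/chromatic_number_le; have [_ /(_ i) rF] := hF; rewrite leqNgt rF.
Qed.

Lemma SPEX_near_constant (eta : R) : 0 < eta -> exists n0 : nat,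
  forall n G, (n0 <= n)%N -> SPEX R n F G ->
  exists x : G -> R, [/\ forall v, 0 <= x v,
    forall v, spectral_radius R G * x v <= \sum_(w | adj v w) x w &
    \sum_v (x v - 1) ^+ 2 <= eta * n%:R].
Proof.
move=> eta_gt0; pose eps := eta / 4.
have eps_gt0 : 0 < eps by rewrite divr_gt0.
have [delta delta_gt0 dens] :=
  @multipartite_free_wedges_le R r t eps (ltnW r_gt1) isT eps_gt0.
have [n0 n0_gt] := exists_natr_gt (6 + 3 / delta + 6 / (2 * eps)).
exists n0 => n G n0n GS; have [Gn _ _] := GS.
have n_gt : 6 + 3 / delta + 6 / (2 * eps) < n%:R :> R.
  by apply: lt_le_trans n0_gt _; rewrite ler_nat.
have d3 : 0 < 3 / delta by rewrite divr_gt0.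
have e6 : 0 < 6 / (2 * eps) by rewrite divr_gt0 // mulr_gt0.
have n0' : 0 < n%:R :> R by lra.
have n_gt0 : (0 < n)%N by rewrite -(ltr_nat R).
have G_gt0 : (0 < #|G|)%N by rewrite Gn.
have [x [x_ge0 x_sum x_sub]] := @spectral_subeigenvector R G G_gt0.
exists x; split=> //; rewrite Gn in x_sum.
have rho_ge := SPEX_spectral_radius_ge n_gt0 GS.
set rho := spectral_radius R G in x_sub rho_ge.
have rho_ge3 : n%:R / 3 <= rho by have := ler_wpM2r (ltW n0') rV_le; lra.
have nbr_le v : \sum_(w | adj v w) x w <= n%:R.
  rewrite -x_sum big_mkcond; apply: ler_sum => w _; by case: ifP.
(* From [n / 3 * x v <= rho * x v <= n]. Bounded entries make the weights [x v / n] at most [delta],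
   as the density bound requires. *)
have x_le3 v : x v <= 3.
  rewrite leNgt; apply/negP => xv.
  have := le_trans (x_sub v) (nbr_le v).
  have : n%:R / 3 * x v <= rho * x v by rewrite ler_wpM2r.
  have : n%:R / 3 * 3 < n%:R / 3 * x v by rewrite ltr_pM2l // divr_gt0.
  lra.
pose S := \sum_v x v ^+ 2.
have S_le3 : S <= 3 * n%:R.
  rewrite -x_sum mulr_sumr; apply: ler_sum => v _.
  by rewrite expr2 ler_wpM2r.
have S_ge0 : 0 <= S by apply: sumr_ge0 => v _; exact: sqr_ge0.
have W_le : \sum_v x v * (\sum_(w | adj v w) x w) <=
    (1 - r%:R^-1 + eps) * n%:R ^+ 2.
  have : wedges (fun v => n%:R^-1 * x v) <= 1 - r%:R^-1 + eps.
    apply: dens => [P|v|]; first exact: SPEX_multipartite_free GS.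
      rewrite mulr_ge0 ?invr_ge0 ?ler0n //= mulrC ler_pdivrMr //.
      apply: le_trans (x_le3 v) _; rewrite -ler_pdivrMl // mulrC; lra.
    by rewrite /mass -mulr_sumr x_sum mulVf // gt_eqF.
  by rewrite wedgesZ wedgesE exprVn mulrC ler_pdivrMr // exprn_gt0.
have rhoS : rho * S <= \sum_v x v * (\sum_(w | adj v w) x w).
  rewrite mulr_sumr; apply: ler_sum => v _.
  by rewrite expr2 mulrCA ler_wpM2l.
have -> : \sum_v (x v - 1) ^+ 2 = S - n%:R.
  transitivity (S - 2 * (\sum_v x v) + #|G|%:R); last by rewrite x_sum Gn; ring.
  rewrite -sum1_card natr_sum mulr_sumr -sumrB -big_split /=.
  by apply: eq_bigr => v _; ring.
have aS : ((1 - r%:R^-1) * n%:R - 1) * S <= (1 - r%:R^-1 + eps) * n%:R ^+ 2.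
  by apply: le_trans W_le; apply: le_trans rhoS; rewrite ler_wpM2r.
(* The [3] absorbs the [-1] in the Turan bound, through [S <= 3 * n]. *)
have aS' : (1 - r%:R^-1) * (S - n%:R) <= eps * n%:R + 3.
  rewrite -(ler_pM2l n0'); move: aS S_le3; lra.
have en : 6 <= 2 * eps * n%:R.
  by rewrite mulrC -ler_pdivrMr ?mulr_gt0 //; lra.
have -> : eta * n%:R = 2 * (2 * eps * n%:R) by rewrite /eps; field.
have [S_le|/ltW S_ge] := leP (S - n%:R) 0.
  by apply: le_trans S_le _; lra.
have : 2^-1 * (S - n%:R) <= (1 - r%:R^-1) * (S - n%:R).
  by rewrite ler_wpM2r //; have := rV_le; lra.
lra.
Qed.

Lemma SPEX_degree_gt (theta : R) : 0 < theta -> exists n0 : nat,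
  forall n G, (n0 <= n)%N -> SPEX R n F G ->
  forall u : G, (1 - r%:R^-1 - theta) * n%:R < (degree u)%:R.
Proof.
move=> theta_gt0.
have [q rE] : exists q, r = q.+2 by case: (r) r_gt1 => [|[|q]] // _; exists q.
pose a : R := 1 - r%:R^-1.
have a_ge : 2^-1 <= a by rewrite /a; have := rV_le; lra.
have a_le1 : a <= 1 by rewrite /a; have := rV_gt0; lra.
pose gap : R := q.+1%:R^-1 - r%:R^-1.
have gap_gt0 : 0 < gap by rewrite subr_gt0 rE ltf_pV2 ?posrE ?ltr0n // ltr_nat.
have gap_le1 : gap <= 1.
  have : q.+1%:R^-1 <= 1 :> R by rewrite invf_le1 ?ltr0n // ler1n.
  by move=> q_le; rewrite /gap lerBlDr (le_trans q_le) // lerDl ltW // rV_gt0.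
pose T6 : R := 4 + 6 * t%:R.
have T6_gt0 : 0 < T6 by rewrite ltr_wpDr // mulr_ge0 // ler0n.
pose kappa := Num.min 2^-1 (theta / (4 * T6)).
have k_gt0 : 0 < kappa by rewrite lt_min invr_gt0 ltr0n !divr_gt0 // mulr_gt0.
have k_le : kappa <= 2^-1 by rewrite ge_min lexx.
have k_theta : kappa * T6 <= theta / 4.
  have : kappa <= theta / (4 * T6) by rewrite ge_min lexx orbT.
  move/(ler_wpM2r (ltW T6_gt0))/le_trans; apply.
  rewrite (_ : theta / (4 * T6) * T6 = theta / 4) //.
  by field; rewrite gt_eqF.
(* The bounds serve in turn: the degree hypothesis of [common_nbhd], the density needed to find [r]
   parts inside [B], and the final error [2 * eta * n]. *)
pose eta := Num.min (Num.min 1 (kappa / (3 * r%:R)))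
  (Num.min (gap / 10) (theta / 12)).
have eta_gt0 : 0 < eta.
  by rewrite !lt_min ltr01 !divr_gt0 // mulr_gt0.
have eta_le1 : eta <= 1 by rewrite !ge_min lexx.
have eta_k : 3 * eta <= kappa / r%:R.
  have : eta <= kappa / (3 * r%:R) by rewrite !ge_min lexx !orbT.
  have -> : kappa / (3 * r%:R) = kappa / r%:R / 3 by field; rewrite gt_eqF.
  lra.
have eta_gap : eta <= gap / 10 by rewrite !ge_min lexx !orbT.
have eta_theta : eta <= theta / 12 by rewrite !ge_min lexx !orbT.
clearbody kappa eta.
have [M M_gt] := exists_natr_gt (t%:R / kappa).
have tM : t%:R <= kappa * M%:R.
  by rewrite mulrC -ler_pdivrMr // ltW.
have M_gt0 : (0 < M)%N.
  by rewrite -(ltr_nat R) (le_lt_trans _ M_gt) // divr_ge0 ?ler0n // ltW.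
have gap2_gt0 : 0 < gap / 2 by rewrite divr_gt0.
have [delta delta_gt0 ES] := @erdos_stone R q M (gap / 2) M_gt0 gap2_gt0.
(* With the cube, Chebyshev's inequality leaves at most [eta * n] vertices where [x v < 1 - eta]. *)
have [n1 near] := SPEX_near_constant (exprn_gt0 3 eta_gt0).
pose K : R := (2 ^ (r * M) * t)%:R / kappa.
have K_ge0 : 0 <= K by rewrite divr_ge0 ?ler0n // ltW.
have [n2 n2_gt] := exists_natr_gt (3 + delta^-1 + eta^-1 + K + 4 / theta).
exists (maxn n1 n2) => n G; rewrite geq_max => /andP[n1n n2n] GS u.
have n_gt : 3 + delta^-1 + eta^-1 + K + 4 / theta < n%:R :> R.
  by apply: lt_le_trans n2_gt _; rewrite ler_nat.
have dV : 0 < delta^-1 by rewrite invr_gt0.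
have eV : 0 < eta^-1 by rewrite invr_gt0.
have tV : 0 < 4 / theta by rewrite divr_gt0.
have n0 : 0 < n%:R :> R by lra.
have n_gt0 : (0 < n)%N by rewrite -(ltr_nat R).
have dn : n%:R^-1 <= delta by rewrite invf_ple ?posrE //; lra.
have en : 1 <= eta * n%:R by rewrite -ler_pdivrMl // mulr1; lra.
have Kn : (2 ^ (r * M) * t)%:R <= kappa * n%:R.
  by rewrite -ler_pdivrMl // mulrC; rewrite /K in n_gt; lra.
have thn : 4 < theta * n%:R by rewrite -ltr_pdivrMl // mulrC; lra.
have [Gn _ _] := GS; have [x [x_ge0 x_sub x_near]] := near n G n1n GS.
have rho_ge := SPEX_spectral_radius_ge n_gt0 GS.
rewrite -/a in rho_ge *.
set rho := spectral_radius R G in x_sub rho_ge.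
have rho_gt0 : 0 < rho by have := ler_wpM2r (ltW n0) a_ge; lra.
have sum_near (P : pred G) : `|\sum_(v | P v) x v - #|P|%:R| <= eta * n%:R.
  apply: sum_near_card => //; last by rewrite Gn.
  apply: le_trans x_near _; rewrite exprSr ler_wpM2r ?ler0n // ler_piMr //.
  by rewrite exprn_ge0 // ltW.
pose B := [set v | 1 - eta <= x v].
have B_large : #|~: B|%:R <= eta * n%:R.
  have : eta ^+ 2 * #|~: B|%:R <= eta ^+ 2 * (eta * n%:R).
    rewrite mulrA -exprSr; apply: le_trans x_near.
    rewrite mulrC -sum1_card natr_sum mulr_suml big_mkcond; apply: ler_sum => v _.
    rewrite !inE mul1r; have [_|xv] := leP (1 - eta) (x v); first exact: sqr_ge0.
    by rewrite /= -[leRHS]sqrrN lerXn2r // ?nnegrE; lra.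
  by rewrite ler_pM2l // exprn_gt0.
have degE v : (degree v)%:R = #|[pred w | adj v w]|%:R :> R.
  by rewrite /degree cardsE.
have B_deg v : v \in B -> (a - 3 * eta) * n%:R <= (degree v)%:R.
  rewrite inE => xv.
  have := sum_near [pred w | adj v w]; rewrite -degE ler_norml => /andP[_ /= sum_le].
  have := x_sub v.
  have : rho * (1 - eta) <= rho * x v by rewrite ler_wpM2l // ltW.
  have : (a * n%:R - 1) * (1 - eta) <= rho * (1 - eta).
    by rewrite ler_wpM2r // subr_ge0.
  have : a * (eta * n%:R) <= eta * n%:R by rewrite ler_piMl // mulr_ge0 // ltW.
  lra.
(* Weight supported on [B]: its density is at least [(1 - eta) * (a - 4 * eta) >= a - gap / 2], the
   Erdos-Stone threshold for [r = q.+2] parts with surplus [gap / 2]. *)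
pose p v : R := n%:R^-1 * (v \in B)%:R.
have [P [PP PB]] : exists P, complete_multipartite q.+2 M P /\
    forall i v, (i < q.+2)%N -> v \in P i -> 0 < p v.
  apply: ES => [v||].
  - rewrite /p mulr_ge0 ?invr_ge0 ?ler0n //=; apply: le_trans dn.
    by rewrite ler_piMr ?invr_ge0 ?ler0n // lern1 leq_b1.
  - rewrite /mass /p -mulr_sumr mulrC ler_pdivrMr // mul1r -Gn -sum1_card natr_sum.
    by apply: ler_sum => v _; rewrite lern1 leq_b1.
  have -> : wedges p = n%:R^-1 ^+ 2 * wedges (fun v : G => (v \in B)%:R).
    by rewrite wedgesZ.
  rewrite exprVn [leRHS]mulrC ler_pdivlMr ?exprn_gt0 // wedgesE.
  have B_ge : (1 - eta) * n%:R <= #|B|%:R.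
    have := cardsC B; rewrite Gn => /(congr1 (GRing.natmul (1 : R))).
    by rewrite natrD; lra.
  apply: le_trans (_ : #|B|%:R * ((a - 4 * eta) * n%:R) <= _); last first.
    rewrite -sum1_card natr_sum mulr_suml big_mkcond; apply: ler_sum => v _.
    case: (boolP (v \in B)) => vB; last by rewrite mul0r.
    rewrite !mul1r.
    have : (degree v)%:R <= \sum_(w | adj v w) (w \in B)%:R + #|~: B|%:R :> R.
      rewrite degE -!sum1_card !natr_sum big_mkcond [X in X + _]big_mkcond.
      rewrite [X in _ + X]big_mkcond -big_split /=; apply: ler_sum => w _.
      rewrite !inE; case: (adj v w); case: (1 - eta <= x w) => /=;
        by rewrite ?addr0 ?add0r.
    have := B_deg v vB; lra.
  have a4 : 0 <= a - 4 * eta by lra.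
  have := ler_wpM2r (mulr_ge0 a4 (ltW n0)) B_ge.
  apply: le_trans.
  have -> : 1 - q.+1%:R^-1 + gap / 2 = a - gap / 2
    by rewrite /a /gap; move: (q.+1%:R^-1) (r%:R^-1) => A b; field.
  have -> : (1 - eta) * n%:R * ((a - 4 * eta) * n%:R) =
      (1 - eta) * (a - 4 * eta) * n%:R ^+ 2 by ring.
  rewrite ler_wpM2r ?exprn_ge0 ?ler0n //.
  have : eta * a <= eta by rewrite ler_piMr // ltW.
  have := sqr_ge0 eta; lra.
rewrite -rE in PP PB.
have noP P' := @SPEX_multipartite_free n G P' GS.
have degP i v : (i < r)%N -> v \in P i ->
    (1 - r%:R^-1 - kappa / r%:R) * #|G|%:R <= (degree v)%:R.
  move=> ir vP; have vB : v \in B.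
    by have := PB i v ir vP; rewrite /p; case: (v \in B); rewrite ?mulr0 ?ltxx.
  apply: le_trans (B_deg v vB); rewrite Gn ler_wpM2r ?ler0n // -/a; lra.
have [||T Tt] := @common_nbhd R G r t M P kappa (ltnW r_gt1) isT k_gt0 _ tM _
  PP noP degP.
- lra.
- by rewrite Gn.
rewrite Gn -/a => T_ge.
have FT i : (#|F i|.+1 < #|T|)%N by rewrite Tt; exact: F_lt_t.
have := SPEX_weight_le u GS rho_gt0 FT x_ge0 x_sub.
have := sum_near [pred w | adj u w]; rewrite -degE ler_norml => /andP[_ /= N_le].
set S := [pred w | [forall v in T, adj v w] && (w != u)].
have := sum_near S; rewrite ler_norml => /andP[/= S_ge _].
(* The rewired neighbourhood leaves out [u] itself. *)
have S_card : #|[set w | [forall v in T, adj v w]]|%:R <= #|S|%:R + 1 :> R.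
  rewrite natr1 ler_nat (cardsD1 u) -add1n leq_add ?leq_b1 //.
  by apply/subset_leq_card/fintype.subsetP => w; rewrite !inE andbC.
have T6E : (a - 4 * kappa - 6 * t%:R * kappa) * n%:R = a * n%:R - kappa * T6 * n%:R.
  by rewrite /T6; ring.
have := ler_wpM2r (ltW n0) k_theta.
have := ler_wpM2r (ltW n0) eta_theta.
rewrite T6E in T_ge; lra.
Qed.
End Extremal.

(** * Connectivity and the final theorem *)

(** For [r = 2] the degree bound alone would allow two halves. But a component [A] keeps all its
    degrees, and its size is below [(b + b / 8) * n] because the rest contains a closed
    neighbourhood-rich component too; so [A] would be denser than multipartite-freeness permits. *)
Lemma connected_of_degree (R : realType) (r t : nat) : (1 < r)%N -> (0 < t)%N ->
  exists n0 : nat, forall G : sgraph, (n0 <= #|G|)%N ->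
    (forall P, ~ @complete_multipartite G r.+1 t P) ->
    (forall u : G, (1 - r%:R^-1 - (8 * r%:R)^-1) * #|G|%:R < (degree u)%:R :> R) ->
    connected_graph G.
Proof.
move=> r_gt1 t_gt0.
have r0 : 0 < r%:R :> R by rewrite ltr0n ltnW.
pose b : R := r%:R^-1.
have b_gt0 : 0 < b by rewrite invr_gt0.
have b_le : b <= 2^-1 by rewrite lef_pV2 ?posrE // ler_nat.
have bE : (8 * r%:R)^-1 = b / 8 by rewrite /b; field; rewrite gt_eqF.
have b2_gt0 : 0 < b / 2 by rewrite divr_gt0.
have [delta delta_gt0 dens] :=
  @multipartite_free_wedges_le R r t (b / 2) (ltnW r_gt1) t_gt0 b2_gt0.
have [n0 n0_gt] := exists_natr_gt (4 / delta).
exists n0 => G n0G noP; rewrite bE -/b => deg_gt x y.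
apply: contrapT => /negP xy; set n : R := #|G|%:R in deg_gt.
have n_gt : 4 / delta < n by apply: lt_le_trans n0_gt _; rewrite ler_nat.
have n_gt0 : 0 < n by apply: le_lt_trans n_gt; rewrite divr_ge0 // ltW.
pose A := [set z | connect (@adj G) x z].
have adjA v w : adj v w -> (v \in A) = (w \in A).
  move=> vw; rewrite !inE; apply/idP/idP => xv; apply: connect_trans xv _.
    exact: connect1.
  by apply: connect1; rewrite adj_sym.
have degA : (degree x <= #|A|)%N.
  apply/subset_leq_card/fintype.subsetP => w; rewrite inE => /adjA <-.
  by rewrite inE connect0.
have degC : (degree y <= #|~: A|)%N.
  apply/subset_leq_card/fintype.subsetP => w; rewrite !inE => /adjA.
  by rewrite !inE (negPf xy) => <-.
have nE : #|A|%:R + #|~: A|%:R = n by rewrite -natrD cardsC.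
have A_ge : (1 - b - b / 8) * n < #|A|%:R.
  by apply: lt_le_trans (deg_gt x) _; rewrite ler_nat.
have C_ge : (1 - b - b / 8) * n < #|~: A|%:R.
  by apply: lt_le_trans (deg_gt y) _; rewrite ler_nat.
set m : R := #|A|%:R in nE A_ge.
have bn := ler_wpM2r (ltW n_gt0) b_le.
have m_gt : n / 4 < m by lra.
have m_gt0 : 0 < m by lra.
have := dens G (fun v => m^-1 * (v \in A)%:R) noP.
rewrite wedgesZ exprVn mulrC ler_pdivrMr ?exprn_gt0 //.
have -> : wedges (fun v : G => (v \in A)%:R) = \sum_(v in A) (degree v)%:R :> R.
  rewrite wedgesE [RHS]big_mkcond; apply: eq_bigr => v _.
  case: (boolP (v \in A)) => vA; last by rewrite mul0r.
  rewrite mul1r /degree -sum1_card natr_sum; apply: eq_big => w; first by rewrite inE.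
  by move/adjA; rewrite vA => <-.
have deg_sum : m * ((1 - b - b / 8) * n) <= \sum_(v in A) (degree v)%:R.
  rewrite /m -sum1_card natr_sum mulr_suml; apply: ler_sum => v _.
  by rewrite mul1r ltW.
move=> H; have {H} : \sum_(v in A) (degree v)%:R <= (1 - b + b / 2) * m ^+ 2.
  apply: H => [v|].
    rewrite mulr_ge0 ?invr_ge0 ?ler0n ?(ltW m_gt0) //=.
    apply: le_trans (_ : m^-1 <= _).
      by rewrite ler_piMr ?invr_ge0 ?ler0n ?(ltW m_gt0) // lern1 leq_b1.
    rewrite invf_ple ?posrE // ltW // (lt_trans _ m_gt) //.
    by rewrite ltr_pdivlMr // mulrC.
  rewrite /mass -mulr_sumr mulrC ler_pdivrMr // mul1r /m -sum1_card natr_sum.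
  by rewrite [leRHS]big_mkcond; apply: ler_sum => v _; case: (v \in A).
move=> /(le_trans deg_sum); rewrite expr2 [leRHS]mulrCA ler_pM2l // => main.
have m_lt : m < (b + b / 8) * n by lra.
have c_ge0 : 0 <= 1 - b + b / 2 by lra.
have := ler_wpM2l c_ge0 (ltW m_lt).
(* The inequalities would force [1 < 9 / 4 * b - 9 / 16 * b ^+ 2]. The product is [63 / 64] minus
   that right side, so the latter is below [1]. *)
have slack : 0 <= (2^-1 - b) * (9 / 4 - 9 / 16 * (2^-1 + b)).
  by apply: mulr_ge0; lra.
have := mulr_ge0 slack (ltW n_gt0); lra.
Qed.

Theorem lemma1p3 (R : realType) (I : finType) (F : I -> sgraph) (r : nat)
    (hr : (3 <= r.+1)%N) (hF : family_min_chromatic F r.+1)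
    (theta : R) (htheta : 0 < theta) :
  exists n0 : nat, forall (n : nat) (G : sgraph),
    (n0 <= n)%N -> SPEX R n F G ->
    connected_graph G /\
    ((r%:R - 1) / r%:R - theta) * n%:R < (min_degree G)%:R.
Proof.
have r0 : 0 < r%:R :> R by rewrite ltr0n ltnW.
(* A single degree bound then yields both the claimed minimum degree and the hypothesis of
   [connected_of_degree]. *)
pose th := Num.min theta (8 * r%:R)^-1.
have th_gt0 : 0 < th by rewrite lt_min htheta invr_gt0 mulr_gt0.
have [n1 degP] := SPEX_degree_gt hr hF th_gt0.
have [n2 connP] := @connected_of_degree R r (\max_i #|F i|).+2 hr isT.
exists (maxn 1 (maxn n1 n2)) => n G; rewrite !geq_max => /and3P[n_gt0 n1n n2n] GS.
have [Gn _ _] := GS.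
have n0 : 0 < n%:R :> R by rewrite ltr0n.
have deg_gt tau (u : G) : th <= tau -> (1 - r%:R^-1 - tau) * n%:R < (degree u)%:R.
  move=> th_le; apply: le_lt_trans (degP n G n1n GS u).
  by rewrite ler_wpM2r ?ler0n // lerB.
split.
  apply: connP; first by rewrite Gn.
    by move=> P; exact: SPEX_multipartite_free GS.
  by move=> u; rewrite Gn deg_gt // ge_min lexx orbT.
have -> : (r%:R - 1) / r%:R - theta = 1 - r%:R^-1 - theta.
  by rewrite mulrBl mul1r divff // gt_eqF.
rewrite /min_degree; elim/big_ind: _ => [|i j ? ?|u _].
(* The default value [#|G| = n] of the minimum must exceed the bound as well, which uses [n > 0]. *)
- rewrite Gn gtr_pMl //.
  have : 0 < r%:R^-1 :> R by rewrite invr_gt0.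
  lra.
- by rewrite /minn; case: ifP.
- by rewrite deg_gt // ge_min lexx.
Qed.
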